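(* Let $\mu,\nu,k$ be integers with $0\le k\le\mu<\nu$, and for $f\in C(\mathbb{CP}^1)$ let $E^\nu_{\mu,k}(f):=R_{\mu+\nu-2k}\big(\mathcal{T}^\nu_{\mu,k}(R_\mu^*(f))\big)$. Then $$E^\nu_{\mu,k}(f)=C_{\mu,\nu,k}^2\sum_{l=0}^k(-1)^{k-l}\binom{\nu-k}{k-l}\frac{(\nu-k+l)!\,k!}{\nu!\,l!}\,B_{\mu-l}(f).$$
   Context: For an integer $\tau\ge0$, $\mathcal{H}_\tau$ is the space of polynomials in one complex variable of degree $\le\tau$, with inner product $\langle f,g\rangle=\int_{\mathbb{C}}f\overline g\,d\iota_\tau$, $d\iota_\tau(z)=\frac{\tau+1}{(1+|z|^2)^\tau}\frac{dA(z)}{\pi(1+|z|^2)^2}$ ($dA$ Lebesgue measure); $d\iota:=d\iota_0$ (a probability measure). $\mathcal{H}_\tau$ has reproducing kernel $K^\tau(x,y)=(1+x\overline y)^\tau$; the kernel of an operator $\Gamma$ on $\mathcal{H}_\tau$ is $\Gamma(x,y):=\Gamma(K^\tau(\cdot,y))(x)$. $C(\mathbb{CP}^1)$ denotes continuous functions on $\mathbb{C}$ extending continuously to $\mathbb{C}\cup\{\infty\}$. Define $R_\tau(\Gamma)(z)=\Gamma(z,z)/(1+|z|^2)^\tau$ for $\Gamma\in B(\mathcal{H}_\tau)$; for a function $f$, $R_\tau^*(f)$ is the operator on $\mathcal{H}_\tau$ given by $(R_\tau^*(f)h)(x)=\frac1{\tau+1}\int_{\mathbb{C}}f(z)h(z)(1+x\overline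 z)^\tau d\iota_\tau(z)$; the Berezin transform is $B_\tau(f)(z)=R_\tau R_\tau^*(f)(z)=\int_{\mathbb{C}}\frac{|1+z\overline s|^{2\tau}}{(1+|z|^2)^\tau(1+|s|^2)^\tau}f(s)\,d\iota(s)$. $\mathcal{H}_\mu\otimes\mathcal{H}_\nu$ is realized as polynomials $F(z,w)$ of degree $\le\mu$ in $z$, $\le\nu$ in $w$, with inner product of $L^2(d\iota_\mu(z)d\iota_\nu(w))$. $J_k(F)(\xi)=\int_{\mathbb{C}^2}F(z,w)(\overline z-\overline w)^k(1+\xi\overline z)^{\mu-k}(1+\xi\overline w)^{\nu-k}d\iota_\mu(z)d\iota_\nu(w)$ maps into $\mathcal{H}_{\mu+\nu-2k}$; $C_{\mu,\nu,k}^2:=\frac{(-\nu)_k(-\mu)_k}{k!(\mu+\nu-2k+2)_k}$ (rising Pochhammer $(a)_n=a(a+1)\cdots(a+n-1)$), $C_{\mu,\nu,k}>0$; $P_k=C_{\mu,\nu,k}J_k$; $\mathcal{T}^\nu_{\mu,k}(A)=P_k(A\otimes I)P_k^*$ for $A\in B(\mathcal{H}_\mu)$, $I$ the identity of $\mathcal{H}_\nu$. *)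

(* Defs.v *)
From HB Require Import structures.
From mathcomp Require Import all_boot all_order all_algebra.
From mathcomp Require Import all_classical all_reals all_analysis.
From mathcomp Require Import complex.
Set Implicit Arguments. Unset Strict Implicit. Unset Printing Implicit Defensive.
Import Order.TTheory GRing.Theory Num.Theory.
Local Open Scope ring_scope.

Definition cRe {R : realType} (z : R[i]) : R := @complex.Re R z.
Definition cIm {R : realType} (z : R[i]) : R := @complex.Im R z.
Definition cR {R : realType} (x : R) : R[i] := Complex x 0.
Definition cconj {R : realType} (z : R[i]) : R[i] := Complex (cRe z) (- cIm z).
Definition abs2 {R : realType} (z : R[i]) : R := cRe z ^+ 2 + cIm z ^+ 2.
Definition cmod {R : realType} (z : R[i]) : R := Num.sqrt (abs2 z).

Notation lebC R := ((@lebesgue_measure R) \x (@lebesgue_measure R))%E.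

Definition intC {R : realType} (g : R[i] -> R[i]) : R[i] :=
  Complex (Rintegral (lebC R) setT (fun p => cRe (g (Complex p.1 p.2))))
          (Rintegral (lebC R) setT (fun p => cIm (g (Complex p.1 p.2)))).

(* \int_{C^2} G dA(z) dA(w), with respect to Lebesgue measure on C x C = R^4,
   built as the product measure ((dx1 x dy1) x dx2) x dy2, z = x1 + i y1, w = x2 + i y2 *)
Notation lebC2 R := ((((@lebesgue_measure R) \x (@lebesgue_measure R))
                       \x (@lebesgue_measure R)) \x (@lebesgue_measure R))%E.
Definition intC2 {R : realType} (G : R[i] -> R[i] -> R[i]) : R[i] :=
  Complex
    (Rintegral (lebC2 R) setT
       (fun p => cRe (G (Complex p.1.1.1 p.1.1.2) (Complex p.1.2 p.2))))
    (Rintegral (lebC2 R) setT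
       (fun p => cIm (G (Complex p.1.1.1 p.1.1.2) (Complex p.1.2 p.2)))).

Definition dens {R : realType} (tau : nat) (z : R[i]) : R :=
  (tau.+1)%:R / (pi * (1 + abs2 z) ^+ (tau + 2)).

Definition int_iota {R : realType} (tau : nat) (g : R[i] -> R[i]) : R[i] :=
  intC (fun z => g z * cR (dens tau z)).

Definition int_iota2 {R : realType} (mu nu : nat) (G : R[i] -> R[i] -> R[i]) : R[i] :=
  intC2 (fun z w => G z w * cR (dens mu z) * cR (dens nu w)).

Definition inH {R : realType} (tau : nat) (h : R[i] -> R[i]) : Prop :=
  exists p : {poly R[i]}, (size p <= tau.+1)%N /\ forall z, h z = p.[z].

Definition inH2 {R : realType} (mu nu : nat) (F : R[i] -> R[i] -> R[i]) : Prop :=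
  exists c : 'M[R[i]]_(mu.+1, nu.+1),
    forall z w, F z w = \sum_(i < mu.+1) \sum_(j < nu.+1) c i j * z ^+ i * w ^+ j.

Definition ip {R : realType} (tau : nat) (f g : R[i] -> R[i]) : R[i] :=
  int_iota tau (fun z => f z * cconj (g z)).
Definition ip2 {R : realType} (mu nu : nat) (F G : R[i] -> R[i] -> R[i]) : R[i] :=
  int_iota2 mu nu (fun z w => F z w * cconj (G z w)).

Definition Kern {R : realType} (tau : nat) (x y : R[i]) : R[i] :=
  (1 + x * cconj y) ^+ tau.

(* operators on H_tau, represented as maps on functions *)
Definition op (R : realType) := (R[i] -> R[i]) -> (R[i] -> R[i]).

(* R_tau(Gamma)(z) = Gamma(z,z)/(1+|z|^2)^tau, Gamma(x,y) = Gamma(K^tau(.,y))(x) *)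
Definition Rtau {R : realType} (tau : nat) (Gam : op R) (z : R[i]) : R[i] :=
  Gam (fun x => Kern tau x z) z / cR ((1 + abs2 z) ^+ tau).

Definition Rstar {R : realType} (tau : nat) (f : R[i] -> R[i]) : op R :=
  fun h x => cR (tau.+1%:R)^-1 *
             int_iota tau (fun z => f z * h z * (1 + x * cconj z) ^+ tau).

Definition Berezin {R : realType} (tau : nat) (f : R[i] -> R[i]) (z : R[i]) : R[i] :=
  int_iota 0 (fun s => cR (abs2 (1 + z * cconj s) ^+ tau /
                           ((1 + abs2 z) ^+ tau * (1 + abs2 s) ^+ tau)) * f s).

Definition poch {R : realType} (a : R) (n : nat) : R := \prod_(i < n) (a + i%:R).

Definition Csq {R : realType} (mu nu k : nat) : R :=
  poch (- nu%:R) k * poch (- mu%:R) k /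
  ((k`!)%:R * poch (mu%:R + nu%:R - 2 * k%:R + 2) k).

Definition Cmnk {R : realType} (mu nu k : nat) : R := Num.sqrt (Csq mu nu k).

Definition Jk {R : realType} (mu nu k : nat) (F : R[i] -> R[i] -> R[i]) (xi : R[i]) : R[i] :=
  int_iota2 mu nu (fun z w => F z w * (cconj z - cconj w) ^+ k *
                              (1 + xi * cconj z) ^+ (mu - k) *
                              (1 + xi * cconj w) ^+ (nu - k)).

Definition Pk {R : realType} (mu nu k : nat) (F : R[i] -> R[i] -> R[i]) : R[i] -> R[i] :=
  fun xi => cR (Cmnk mu nu k) * Jk mu nu k F xi.

Definition is_adjoint_Pk {R : realType} (mu nu k : nat)
  (Q : (R[i] -> R[i]) -> (R[i] -> R[i] -> R[i])) : Prop :=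
  forall g, inH (mu + nu - 2 * k) g ->
    inH2 mu nu (Q g) /\
    forall F, inH2 mu nu F -> ip (mu + nu - 2 * k) (Pk mu nu k F) g = ip2 mu nu F (Q g).

Definition tensI {R : realType} (A : op R) (F : R[i] -> R[i] -> R[i]) : R[i] -> R[i] -> R[i] :=
  fun z w => A (fun z' => F z' w) z.

Definition Top {R : realType} (mu nu k : nat)
  (Q : (R[i] -> R[i]) -> (R[i] -> R[i] -> R[i])) (A : op R) : op R :=
  fun g => Pk mu nu k (tensI A (Q g)).

Definition Eop {R : realType} (mu nu k : nat)
  (Q : (R[i] -> R[i]) -> (R[i] -> R[i] -> R[i])) (f : R[i] -> R[i]) : R[i] -> R[i] :=
  Rtau (mu + nu - 2 * k) (Top mu nu k Q (Rstar mu f)).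

Definition in_C_CP1 {R : realType} (f : R[i] -> R[i]) : Prop :=
  (forall z (e : R), 0 < e -> exists2 d : R, 0 < d &
      forall w, cmod (w - z) < d -> cmod (f w - f z) < e) /\
  (exists L : R[i], forall e : R, 0 < e -> exists M : R,
      forall w, M < cmod w -> cmod (f w - L) < e).

(* Main.v *)
Require Import Defs.
From HB Require Import structures.
From mathcomp Require Import all_boot all_order all_algebra.
From mathcomp Require Import all_classical all_reals all_analysis.
From mathcomp Require Import measurable_realfun complex ring lra zify.
Set Implicit Arguments. Unset Strict Implicit. Unset Printing Implicit Defensive.
Import Order.TTheory GRing.Theory Num.Theory numFieldNormedType.Exports.
Local Open Scope classical_set_scope.
Local Open Scope ring_scope.

(** The reproducing property of H_N, N = mu + nu - 2k, and nondegeneracy of the inner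
    product identify the adjoint of P_k on kernel functions: P_k^* K^N(., y) = C G_y with
    G_y(z, w) = (z - w)^k (1 + z y^-)^(mu - k) (1 + w y^-)^(nu - k), y^- the conjugate.
    Since R_mu^*(f) is (mu + 1)^-1 times the Toeplitz operator of f, this gives
      (1 + |y|^2)^N E(f)(y)
        = C^2 (mu + 1)^-1 int f(s) |1 + s y^-|^(2 (mu - k)) W(s, y) diota_mu(s),
    where W(s, y) is the squared norm of (w - s)^k (1 + w y^-)^(nu - k) in H_nu.
    Pairing with the generating function ((1 + w y^-) + v (w - s))^nu, which is again a
    power of a linear form in w, yields
      binom(nu, k) W = [v^k] (y - s + S v)^k (Y + (y - s)^- v)^(nu - k),
    S = 1 + |s|^2, Y = 1 + |y|^2.  As |y - s|^2 = S Y - |1 + s y^-|^2, expanding in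
    |1 + s y^-|^2 and using the Vandermonde convolution turns the integral into a
    combination of Berezin transforms.

    All operators act on polynomials, so only the moments of diota_tau are needed.  They
    follow from the divergence theorem: with
    M(a, b, n) = int z^a (z^-)^b (1 + |z|^2)^-n dA, integrating the two complex derivatives
    gives (b + 1) M(a, b, n) = n M(a + 1, b + 1, n + 1) = (a + 1) M(a, b, n), which forces
    orthogonality and reduces everything to M(0, 0, 2) = pi. *)

(** * Norms of products of linear forms *)

Section Algebra.
Variable F : numFieldType.
Implicit Types (s t y u : F) (p q : {poly F}) (a b : {poly F}).

(** Up to a scalar, the slice of G_y at z = s as a polynomial in w, once [t] is s and [u] is y^-.
    The name refers to the apolar pairing of degree [n], the sum of p_i q_i / binom(n, i), computed
    below. *)
Definition apolar n k t u : {poly F} :=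
  ('X - t%:P) ^+ k * (1 + u *: 'X) ^+ (n - k).

(** Both sides are the coefficient of v^k w^i in one power, ((1 + u w) + v (w - t))^n = ((1 - t v) +
    w (u + v))^n, expanded by the binomial theorem in two ways. In the proof w is the outer and v
    the inner variable. *)
Lemma apolar_coefE n k i t u : (k <= n)%N -> (i <= n)%N ->
  'C(n, k)%:R * (apolar n k t u)`_i =
  'C(n, i)%:R * ((1 - t *: 'X) ^+ (n - i) * (u%:P + 'X) ^+ i)`_k.
Proof.
move=> kn iin.
pose lft := map_poly (@polyC F) (1 + u *: 'X)
          + ('X)%:P * map_poly polyC ('X - t%:P).
pose rgt := (1 - t *: 'X)%:P + (u%:P + 'X)%:P * 'X : {poly {poly F}}.
have lr : lft = rgt.
  rewrite /lft /rgt rmorphD rmorph1 rmorphB /= map_polyZ map_polyX map_polyC /=.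
  rewrite !polyCD polyCN polyC1 mulrBr mulrDl -!mul_polyC.
  rewrite polyCM (mulrC _ 'X) (mulrC _ 'X).
  rewrite [_ * (t%:P)%:P]mulrC.
  ring.
have E := congr1 (fun P : {poly {poly F}} => (P ^+ n)`_i`_k) lr.
rewrite /lft /rgt !exprDn !coef_sum (bigD1 (Ordinal (kn : k < n.+1)%N)) //= in E.
rewrite [in RHS](bigD1 (Ordinal (iin : i < n.+1)%N)) //= in E.
have lt j : (map_poly (@polyC F) (1 + u *: 'X) ^+ (n - j)
   * ('X%:P * map_poly polyC ('X - t%:P)) ^+ j *+ 'C(n, j))`_i
   = ('X^j * ((apolar n j t u)`_i)%:P) *+ 'C(n, j).
  rewrite coefMn exprMn -!rmorphXn /= mulrCA -rmorphM /= coefCM coef_map /=.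
  by rewrite /apolar (mulrC (('X - t%:P) ^+ j)).
have rt j : ((1 - t *: 'X)%:P ^+ (n - j) * ((u%:P + 'X)%:P * 'X) ^+ j *+ 'C(n, j))`_i
   = ((1 - t *: 'X) ^+ (n - j) * (u%:P + 'X) ^+ j) *+ ((i == j) * 'C(n, j)).
  rewrite coefMn exprMn mulrA -!rmorphXn -rmorphM /= coefCM coefXn.
  by case: eqP => _; rewrite ?mulr1 ?mul1n // mulr0 mul0n mul0rn.
rewrite lt rt eqxx mul1n !big1 in E.
- by rewrite !addr0 !coefMn coefMC coefXn eqxx mul1r in E; rewrite !mulr_natl.
- move=> j nj; rewrite rt eq_sym.
  by rewrite -val_eqE /= in nj; rewrite (negbTE nj) mul0n coef0.
- move=> j nj; rewrite lt coefMn coefMC coefXn eq_sym.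
  by rewrite -val_eqE /= in nj; rewrite (negbTE nj) mul0r mul0rn.
Qed.

(** The form of degree [n] with dehomogenization [p], evaluated at the pair (a, b); [n] is a
    parameter since [p] may have smaller degree. *)
Definition homog n a b p : {poly F} :=
  \sum_(i < n.+1) p`_i *: (a ^+ (n - i) * b ^+ i).

Lemma homogSl n a b p : (size p <= n.+1)%N ->
  homog n.+1 a b p = a * homog n a b p.
Proof.
move=> sp; rewrite /homog big_ord_recr /= nth_default // scale0r addr0 mulr_sumr.
by apply: eq_bigr => i _; rewrite -scalerAr mulrA -exprS subSn // -ltnS.
Qed.

Lemma homogSX n a b p : homog n.+1 a b ('X * p) = b * homog n a b p.
Proof.
rewrite /homog big_ord_recl /= coefXM eqxx scale0r add0r mulr_sumr.
by apply: eq_bigr => i _; rewrite coefXM /= subSS -scalerAr mulrCA -exprS.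
Qed.

Lemma homogD n a b p q : homog n a b (p + q) = homog n a b p + homog n a b q.
Proof. by rewrite -big_split; apply: eq_bigr => i _; rewrite coefD scalerDl. Qed.

Lemma homogZ n a b c p : homog n a b (c *: p) = c *: homog n a b p.
Proof. by rewrite scaler_sumr; apply: eq_bigr => i _; rewrite coefZ scalerA. Qed.

Lemma homog_lin n a b c d p : (size p <= n.+1)%N ->
  homog n.+1 a b ((c%:P + d *: 'X) * p) = (c *: a + d *: b) * homog n a b p.
Proof.
move=> sp; rewrite mulrDl mul_polyC -scalerAl homogD !homogZ homogSl // homogSX.
by rewrite mulrDl -!scalerAl.
Qed.

(** Homogenization is multiplicative only when the degrees add up, so the size bound is carried
    through the induction together with the identity. *)
Lemma homog_linX m n a b (c d : F) p : (size p <= n.+1)%N ->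
  (size ((c%:P + d *: 'X) ^+ m * p)%R <= (m + n).+1)%N /\
  homog (m + n) a b ((c%:P + d *: 'X) ^+ m * p) =
    (c *: a + d *: b) ^+ m * homog n a b p.
Proof.
move=> sp; elim: m => [|m [ih1 ih2]]; first by rewrite !expr0 !mul1r.
rewrite exprS -mulrA addSn homog_lin // ih2; split; last by rewrite mulrA -exprS.
apply: leq_trans (size_polyMleq _ _) _.
have s2 : (size (c%:P + d *: 'X)%R <= 2)%N.
  apply: leq_trans (size_polyD _ _) _; rewrite geq_max size_polyC.
  rewrite (leq_trans (size_scale_leq _ _)) ?size_polyX // andbT.
  by case: (c != 0).
by rewrite -subn1 leq_subLR; apply: leq_trans (leq_add s2 ih1) _.
Qed.

Lemma size_apolar n k t u : (k <= n)%N -> (size (apolar n k t u) <= n.+1)%N.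
Proof.
move=> kn; rewrite /apolar -{2}(subnKC kn).
have -> : 'X - t%:P = (- t)%:P + 1%R *: 'X by rewrite scale1r polyCN addrC.
apply: (homog_linX _ 1 1 _ _ _).1 => //.
have := (@homog_linX (n - k) 0 1 1 1 u 1 _).1; rewrite mulr1 addn0; apply.
by rewrite size_poly1.
Qed.

Lemma homog_apolar n k a b t u : (k <= n)%N ->
  homog n a b (apolar n k t u) = (b - t *: a) ^+ k * (a + u *: b) ^+ (n - k).
Proof.
move=> kn; rewrite /apolar -{1}(subnKC kn).
have -> : 'X - t%:P = (- t)%:P + 1%R *: 'X by rewrite scale1r polyCN addrC.
have [s1 h1] := @homog_linX (n - k) 0 a b 1 u 1 (eq_leq (size_poly1 _)).
rewrite mulr1 addn0 in s1 h1.
rewrite (homog_linX _ _ _ _ _ s1).2 h1 /homog big_ord1 coef1 eqxx !scale1r.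
by rewrite scaleNr expr0 mulr1 mulr1 (addrC (- _)).
Qed.

(** Since binom(k, j) binom(j, m) = binom(k, m) binom(k - m, j - m), the remaining sum over [j] is a
    Vandermonde convolution. *)
Lemma sum_binMbin k n m : (m <= k)%N ->
  (\sum_(j < k.+1) 'C(k, j) * 'C(n, j) * 'C(j, m) = 'C(k, m) * 'C(n + k - m, k))%N.
Proof.
move=> mk.
have -> : (n + k - m = (k - m) + n)%N by lia.
rewrite -binomial.Vandermonde big_distrr /= (reindex_inj rev_ord_inj) /=.
apply: eq_bigr => j _; rewrite subSS.
have jk : (j <= k)%N by rewrite -ltnS.
case: (leqP m (k - j)) => h; last first.
  by rewrite (bin_small h) muln0 [X in (_ * (X * _))%N]bin_small ?mul0n ?muln0 //; lia.
rewrite mulnAC mulnA; congr (_ * _)%N.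
have -> : ('C(k - m, j) = 'C(k - m, (k - j) - m))%N.
  by rewrite -[in RHS]bin_sub; [congr ('C(_, _)); lia | lia].
have kjk : (k - j <= k)%N by lia.
have := bin_fact kjk; have := bin_fact h; have := bin_fact mk.
have h2 : (k - j - m <= k - m)%N by lia.
have := bin_fact h2.
have -> : (k - m - (k - j - m) = k - (k - j))%N by lia.
move=> e1 e2 e3 e4.
apply/eqP; rewrite -(eqn_pmul2r (fact_gt0 m)) -(eqn_pmul2r (fact_gt0 (k - j - m))).
rewrite -(eqn_pmul2r (fact_gt0 (k - (k - j)))); apply/eqP.
transitivity (k`!)%N.
  rewrite -e4 -e3; ring.
rewrite -e2 -e1; ring.
Qed.

Lemma coef_linX m (c d : F) i :
  ((c%:P + d *: 'X) ^+ m)`_i = c ^+ (m - i) * d ^+ i *+ 'C(m, i).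
Proof.
rewrite exprDn coef_sum.
have tE j : ((c%:P ^+ (m - j) * (d *: 'X) ^+ j) *+ 'C(m, j))`_i
   = c ^+ (m - j) * d ^+ j * (i == j)%:R *+ 'C(m, j).
  by rewrite coefMn exprZn -polyC_exp mul_polyC !coefZ coefXn mulrA.
case: (ltnP i m.+1) => im; last first.
  rewrite big1 ?bin_small ?mulr0n // => j _; rewrite tE.
  by rewrite (_ : (i == j) = false) ?mulr0 ?mul0rn //; case: j => /= j; lia.
rewrite (bigD1 (Ordinal im)) //= tE eqxx mulr1 big1 ?addr0 // => j nj.
rewrite tE eq_sym; rewrite -val_eqE /= in nj.
by rewrite (negbTE nj) mulr0 mul0rn.
Qed.

(** In the coefficient of X^k the exponents of [al] and [be] agree, so it is a polynomial in their
    product. Expanding (s0 y0 - x)^j and summing over [j] by [sum_binMbin] leaves a single sum over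
    powers of [x]. *)
Lemma coef_linXM k n (x s0 y0 al be : F) : al * be = s0 * y0 - x ->
  ((al%:P + s0 *: 'X) ^+ k * (y0%:P + be *: 'X) ^+ n)`_k =
  \sum_(l < k.+1) (-1) ^+ (k - l) * ('C(k, l) * 'C(n + l, k))%:R *
     x ^+ (k - l) * s0 ^+ l * y0 ^+ (n - (k - l)).
Proof.
move=> ab.
rewrite coefM.
transitivity (\sum_(j < k.+1) \sum_(m < k.+1) ('C(k, j) * 'C(n, j) * 'C(j, m))%:R *
   ((- x) ^+ m * s0 ^+ (k - m) * y0 ^+ (n - m))).
  rewrite (reindex_inj rev_ord_inj) /=; apply: eq_bigr => j _.
  have jk : (j <= k)%N by rewrite -ltnS.
  rewrite subSS !coef_linX subKn // bin_sub //.
  case: (leqP j n) => jn; last first.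
    rewrite (bin_small jn) mulr0n mulr0 big1 // => m _.
    by rewrite muln0 mul0n mul0r.
  transitivity ('C(k, j)%:R * 'C(n, j)%:R * (al * be) ^+ j * s0 ^+ (k - j) * y0 ^+ (n - j)).
    by rewrite exprMn -[in LHS]mulr_natr -[X in _ * X]mulr_natr; ring.
  rewrite ab exprDn.
  rewrite (big_ord_widen k.+1 (fun m => (s0 * y0) ^+ (j - m) * (- x) ^+ m *+ 'C(j, m))) //.
  rewrite big_mkcond mulr_sumr !mulr_suml; apply: eq_bigr => m _ /=.
  rewrite ltnS; case: leqP => [mj|jm]; last first.
    by rewrite (bin_small jm) muln0 mulr0 !mul0r.
  have -> : (k - m = (j - m) + (k - j))%N by lia.
  have -> : (n - m = (j - m) + (n - j))%N by lia.
  by rewrite !exprD exprMn !natrM -mulr_natr; ring.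
rewrite exchange_big /= [RHS](reindex_inj rev_ord_inj) /=.
apply: eq_bigr => m _; have mk : (m <= k)%N by rewrite -ltnS.
rewrite -mulr_suml -natr_sum sum_binMbin // subSS subKn // bin_sub // -addnBA //.
by rewrite (exprNn x); ring.
Qed.

(** A polarized squared norm: [t] and [u] stand for the conjugates of [s] and [y]. By
    [apolar_coefE], pairing with the second factor and multiplying by binom(n, k) amounts to
    evaluating the homogenization of the first factor at (1 - t X, y + X) and taking the coefficient
    of X^k. *)
Lemma apolar_norm n k s t y u : (k <= n)%N ->
  'C(n, k)%:R * \sum_(i < n.+1) (apolar n k s u)`_i * (apolar n k t y)`_i / 'C(n, i)%:R =
  \sum_(l < k.+1) (-1) ^+ (k - l) * ('C(k, l) * 'C(n - k + l, k))%:R *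
    ((1 + s * u) * (1 + t * y)) ^+ (k - l) * (1 + s * t) ^+ l *
    (1 + y * u) ^+ (n - k - (k - l)).
Proof.
move=> kn.
(* The polarized form of |y - s|^2 = (1 + |s|^2)(1 + |y|^2) - |1 + s y^-|^2, with x = (1 + s u)(1 +
   t y). *)
rewrite -(@coef_linXM k (n - k) _ _ _ (y - s) (u - t)); last by ring.
have -> : ((y - s)%:P + (1 + s * t) *: 'X) ^+ k * ((1 + y * u)%:P + (u - t) *: 'X) ^+ (n - k)
   = homog n (1 - t *: 'X) (y%:P + 'X) (apolar n k s u).
  rewrite homog_apolar //; congr (_ ^+ _ * _ ^+ _).
    by rewrite -!mul_polyC polyCB polyCD polyCM polyC1; ring.
  by rewrite -!mul_polyC polyCD polyCB polyCM polyC1; ring.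
rewrite mulr_sumr /homog coef_sum; apply: eq_bigr => i _.
have iin : (i <= n)%N by rewrite -ltnS.
have nz : 'C(n, i)%:R != 0 :> F by rewrite pnatr_eq0 -lt0n bin_gt0.
rewrite coefZ -[in LHS]mulrA [LHS]mulrCA; congr (_ * _).
by rewrite mulrA apolar_coefE // mulrAC divff // mul1r.
Qed.

Lemma apolar_normE n k s t y u : (k <= n)%N ->
  \sum_(i < n.+1) (apolar n k s u)`_i * (apolar n k t y)`_i / 'C(n, i)%:R =
  \sum_(l < k.+1) ((-1) ^+ (k - l) * 'C(n - k, k - l)%:R *
      (((n - k + l)`! * k`!)%:R / (n`! * l`!)%:R)) *
    (((1 + s * u) * (1 + t * y)) ^+ (k - l) * (1 + s * t) ^+ l *
    (1 + y * u) ^+ (n - k - (k - l))).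
Proof.
move=> kn.
have nz : 'C(n, k)%:R != 0 :> F by rewrite pnatr_eq0 -lt0n bin_gt0.
apply: (mulfI nz); rewrite apolar_norm // mulr_sumr; apply: eq_bigr => l _.
have lk : (l <= k)%N by rewrite -ltnS.
have nzf : (n`! * l`!)%:R != 0 :> F by rewrite pnatr_eq0 -lt0n muln_gt0 !fact_gt0.
set b := (_ / _).
suff key : ('C(k, l) * 'C(n - k + l, k))%:R = 'C(n, k)%:R * ('C(n - k, k - l)%:R * b).
  by rewrite key; ring.
apply: (mulIf nzf); rewrite /b !mulrA mulfVK // -!natrM; congr (_ %:R).
(* If k - l > n - k, the subtractions truncate, but binom(n - k, k - l) and binom(n - k + l, k) are
   both zero. *)
have [small|big] := leqP (k - l) (n - k); last first.
  by rewrite (bin_small big) (@bin_small (n - k + l) k) ?muln0 ?mul0n //; lia.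
have e1 := bin_fact kn; have e2 := bin_fact lk; have e3 := bin_fact small.
have h : (k <= n - k + l)%N by lia.
have e4 := bin_fact h.
have hh : (n - k + l - k = n - k - (k - l))%N by lia.
rewrite hh in e4.
apply/eqP; rewrite -(eqn_pmul2r (fact_gt0 (k - l))).
rewrite -(eqn_pmul2r (fact_gt0 (n - k - (k - l)))); apply/eqP.
rewrite -[in RHS]e4.
transitivity ('C(n - k + l, k) * (n`! * k`! * (n - k - (k - l))`!))%N.
  by rewrite -[in RHS]e2; ring.
by rewrite -[in LHS]e1 -[in LHS]e3; ring.
Qed.

End Algebra.

(** * Complex-valued integrals *)

Section ComplexBasics.
Variable R : realType.
Implicit Types z w : R[i].

Lemma cReD z w : cRe (z + w) = cRe z + cRe w. Proof. by case: z; case: w. Qed.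
Lemma cImD z w : cIm (z + w) = cIm z + cIm w. Proof. by case: z; case: w. Qed.
Lemma cReN z : cRe (- z) = - cRe z. Proof. by case: z. Qed.
Lemma cImN z : cIm (- z) = - cIm z. Proof. by case: z. Qed.
Lemma cReM z w : cRe (z * w) = cRe z * cRe w - cIm z * cIm w.
Proof. by case: z; case: w. Qed.
Lemma cImM z w : cIm (z * w) = cRe z * cIm w + cIm z * cRe w.
Proof. by case: z; case: w. Qed.

Lemma cconj_is_additive : additive (@cconj R).
Proof.
move=> [a b] [c d]; apply/eqP; rewrite eq_complex /=; apply/andP; split; apply/eqP.
all: by rewrite /cconj /cRe /cIm /=; ring.
Qed.

Lemma cconj_is_multiplicative : multiplicative (@cconj R).
Proof.
split=> [[a b] [c d]|]; apply/eqP; rewrite eq_complex /=; apply/andP; split; apply/eqP.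
all: by rewrite /cconj /cRe /cIm /=; ring.
Qed.

HB.instance Definition _ := GRing.isAdditive.Build R[i] R[i] (@cconj R) cconj_is_additive.
HB.instance Definition _ :=
  GRing.isMultiplicative.Build R[i] R[i] (@cconj R) cconj_is_multiplicative.

Lemma cconjK : involutive (@cconj R).
Proof. by case=> a b; rewrite /cconj /cRe /cIm /= opprK. Qed.

Lemma cR_is_additive : additive (@cR R).
Proof. exact: (@real_complex_is_additive R). Qed.
Lemma cR_is_multiplicative : multiplicative (@cR R).
Proof. exact: (@real_complex_is_multiplicative R). Qed.
HB.instance Definition _ := GRing.isAdditive.Build R R[i] (@cR R) cR_is_additive.
HB.instance Definition _ := GRing.isMultiplicative.Build R R[i] (@cR R) cR_is_multiplicative.

Lemma cR_inj : injective (@cR R). Proof. by move=> x y []. Qed.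

Lemma cconj_cR (x : R) : cconj (cR x) = cR x.
Proof. by rewrite /cconj /cR /cRe /cIm /= oppr0. Qed.

Lemma cR_abs2 z : cR (abs2 z) = z * cconj z.
Proof.
case: z => a b; apply/eqP; rewrite eq_complex /= /abs2 /cRe /cIm /=.
by apply/andP; split; apply/eqP; ring.
Qed.

Lemma abs2_ge0 z : 0 <= abs2 z. Proof. by rewrite addr_ge0 ?sqr_ge0. Qed.

Lemma abs2M z w : abs2 (z * w) = abs2 z * abs2 w.
Proof. by rewrite /abs2 cReM cImM; ring. Qed.

Lemma abs2_cR (x : R) : abs2 (cR x) = x ^+ 2.
Proof. by rewrite /abs2 /cRe /cIm /= expr0n addr0. Qed.

Lemma abs2X z n : abs2 (z ^+ n) = abs2 z ^+ n.
Proof.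
elim: n => [|n ih]; last by rewrite !exprS abs2M ih.
by rewrite !expr0 -[1 in LHS](rmorph1 (@cR R)) abs2_cR expr1n.
Qed.

Lemma abs2_conj z : abs2 (cconj z) = abs2 z.
Proof. by rewrite /abs2 /cconj /cRe /cIm /= sqrrN. Qed.

Lemma normr_ReIm_le z (b : R) : 0 <= b -> abs2 z <= b ^+ 2 -> `|cRe z| <= b /\ `|cIm z| <= b.
Proof.
move=> b0 zb; have r0 := sqr_ge0 (cRe z); have i0 := sqr_ge0 (cIm z).
split; rewrite -(ger0_norm b0) -ler_sqr ?nnegrE ?normr_ge0 // !real_normK ?num_real //.
  by apply: le_trans zb; rewrite /abs2 lerDl.
by apply: le_trans zb; rewrite /abs2 lerDr.
Qed.

End ComplexBasics.

Section ComplexIntegral.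
Context (R : realType) d (T : measurableType d) (mu : {measure set T -> \bar R}).
Implicit Types (g h : T -> R[i]) (c : R[i]).

Definition Cmeas g := measurable_fun setT (fun x => cRe (g x)) /\
                      measurable_fun setT (fun x => cIm (g x)).

Definition Cintegrable g := mu.-integrable setT (fun x => (cRe (g x))%:E) /\
                            mu.-integrable setT (fun x => (cIm (g x))%:E).

Definition Cintegral g : R[i] :=
  Complex (\int[mu]_x cRe (g x)) (\int[mu]_x cIm (g x)).

Lemma CmeasD g h : Cmeas g -> Cmeas h -> Cmeas (fun x => g x + h x).
Proof.
move=> [g1 g2] [h1 h2]; split.
- by under eq_fun do rewrite cReD; exact: measurable_funD.
- by under eq_fun do rewrite cImD; exact: measurable_funD.
Qed.

Lemma CmeasM g h : Cmeas g -> Cmeas h -> Cmeas (fun x => g x * h x).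
Proof.
move=> [g1 g2] [h1 h2]; split.
- under eq_fun do rewrite cReM.
  by apply: measurable_funB; exact: measurable_funM.
- under eq_fun do rewrite cImM.
  by apply: measurable_funD; exact: measurable_funM.
Qed.

Lemma Cmeas_cst c : Cmeas (fun _ => c).
Proof. by split; exact: measurable_cst. Qed.

Lemma CmeasX g n : Cmeas g -> Cmeas (fun x => g x ^+ n).
Proof.
move=> mg; elim: n => [|n ih]; first exact: Cmeas_cst.
by under eq_fun do rewrite exprS; exact: CmeasM.
Qed.

Lemma Cmeas_conj g : Cmeas g -> Cmeas (fun x => cconj (g x)).
Proof. by move=> [g1 g2]; split => //; exact: measurable_funN. Qed.

Lemma Cmeas_cR (u : T -> R) : measurable_fun setT u -> Cmeas (fun x => cR (u x)).
Proof. by move=> mu'; split => //; exact: measurable_cst. Qed.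

Lemma CintegrableD g h : Cintegrable g -> Cintegrable h ->
  Cintegrable (fun x => g x + h x).
Proof.
move=> [g1 g2] [h1 h2]; split.
- by under eq_fun do rewrite cReD EFinD; exact: integrableD.
- by under eq_fun do rewrite cImD EFinD; exact: integrableD.
Qed.

Lemma CintegralD g h : Cintegrable g -> Cintegrable h ->
  Cintegral (fun x => g x + h x) = Cintegral g + Cintegral h.
Proof.
move=> [g1 g2] [h1 h2]; rewrite /Cintegral.
under eq_Rintegral do rewrite cReD.
under [X in Complex _ X]eq_Rintegral do rewrite cImD.
by rewrite !RintegralD.
Qed.

Lemma CintegrableZ c g : Cintegrable g -> Cintegrable (fun x => c * g x).
Proof.
move=> [g1 g2]; split.
- under eq_fun do rewrite cReM EFinB !EFinM.
  by apply: integrableB => //; exact: integrableZl.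
- under eq_fun do rewrite cImM EFinD !EFinM.
  by apply: integrableD => //; exact: integrableZl.
Qed.

Lemma CintegralZ c g : Cintegrable g ->
  Cintegral (fun x => c * g x) = c * Cintegral g.
Proof.
move=> [g1 g2]; rewrite /Cintegral.
under eq_Rintegral do rewrite cReM.
under [X in Complex _ X]eq_Rintegral do rewrite cImM.
have iZ a (u : T -> R) : mu.-integrable setT (EFin \o u) ->
    mu.-integrable setT (EFin \o (fun x => a * u x)).
  move=> iu; rewrite (_ : _ \o _ = (fun x => a%:E * (u x)%:E)%E) //.
  exact: integrableZl.
rewrite RintegralB ?RintegralD ?RintegralZl //; try exact: iZ.
by case: c.
Qed.

Lemma Cintegrable0 : Cintegrable (fun _ => 0).
Proof. by split; exact: integrable0. Qed.

Lemma Cintegral0 : Cintegral (fun _ => 0) = 0.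
Proof. by rewrite /Cintegral (Rintegral_cst mu measurableT 0) mul0r. Qed.

Lemma Cintegrable_sum (I : Type) (r : seq I) (P : pred I) (g : I -> T -> R[i]) :
  (forall i, P i -> Cintegrable (g i)) -> Cintegrable (fun x => \sum_(i <- r | P i) g i x).
Proof.
move=> ig; elim: r => [|i r ih].
  by under eq_fun do rewrite big_nil; exact: Cintegrable0.
under eq_fun do rewrite big_cons.
by case: (boolP (P i)) => Pi //; apply: CintegrableD => //; exact: ig.
Qed.

Lemma Cintegral_sum (I : Type) (r : seq I) (P : pred I) (g : I -> T -> R[i]) :
  (forall i, P i -> Cintegrable (g i)) ->
  Cintegral (fun x => \sum_(i <- r | P i) g i x) = \sum_(i <- r | P i) Cintegral (g i).
Proof.
move=> ig; elim: r => [|i r ih].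
  by under [X in Cintegral X]eq_fun do rewrite big_nil; rewrite big_nil Cintegral0.
under [X in Cintegral X]eq_fun do rewrite big_cons; rewrite big_cons -ih.
case: (boolP (P i)) => Pi //; rewrite CintegralD //; first exact: ig.
exact: Cintegrable_sum.
Qed.

Lemma le_Cintegrable g (b : T -> R) : Cmeas g -> (forall x, 0 <= b x) ->
  (forall x, abs2 (g x) <= b x ^+ 2) -> mu.-integrable setT (EFin \o b) ->
  Cintegrable g.
Proof.
move=> [m1 m2] b0 gb ib.
by split; apply: le_integrable ib => //; try exact/measurable_EFinP;
  move=> x _ /=; rewrite lee_fin (ger0_norm (b0 x));
  have [] := normr_ReIm_le (b0 x) (gb x).
Qed.

End ComplexIntegral.

(* The library proves that a product of sigma-finite measures is sigma-finite but
   does not attach the corresponding structure to [m1 \x m2]. *)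
Definition sigma_finite_prod (R : realType) d1 d2 (T1 : measurableType d1)
    (T2 : measurableType d2) (m1 : {sigma_finite_measure set T1 -> \bar R})
    (m2 : {sigma_finite_measure set T2 -> \bar R}) :
    {sigma_finite_measure set (T1 * T2)%type -> \bar R} :=
  HB.pack_for {sigma_finite_measure set (T1 * T2)%type -> \bar R} (m1 \x m2)%E
    (lebesgue_integral_fubini.measure_function_Measure_isSigmaFinite__to__measure_function_isSFinite m1 m2)
    (lebesgue_integral_fubini.measure_function_Measure_isSigmaFinite__to__measure_function_isSigmaFinite m1 m2).

(** * Integrals of tensor products over a triple product measure *)

Section ProductIntegral.
Context (R : realType) d1 d2 d3 (T1 : measurableType d1) (T2 : measurableType d2)
  (T3 : measurableType d3).
Variables (m1 : {sigma_finite_measure set T1 -> \bar R})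
  (m2 : {sigma_finite_measure set T2 -> \bar R})
  (m3 : {sigma_finite_measure set T3 -> \bar R}).

Let prj1 : measurable_fun setT (fun p : T1 * T2 * T3 => p.1.1).
Proof. exact: (measurableT_comp measurable_fst measurable_fst). Qed.

Let prj2 : measurable_fun setT (fun p : T1 * T2 * T3 => (p.1.2, p.2)).
Proof.
apply: measurable_fun_pair; last exact: measurable_snd.
exact: (measurableT_comp measurable_snd measurable_fst).
Qed.

Let tens (g : T1 -> R) (h : T2 * T3 -> R) (p : T1 * T2 * T3) : R :=
  g p.1.1 * h (p.1.2, p.2).

Let measurable_tens g h : measurable_fun setT g -> measurable_fun setT h ->
  measurable_fun setT (tens g h).
Proof.
move=> mg mh; apply: measurable_funM.
- exact: (measurableT_comp mg prj1).
- exact: (measurableT_comp mh prj2).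
Qed.

(** The first two measures are bracketed together while [h] lives on the last two; Tonelli, first
    over [T3] and then over [T2], does the regrouping through the partial integral [H]. *)
Lemma ge0_integral_tens (g : T1 -> R) (h : T2 * T3 -> R) :
  measurable_fun setT g -> measurable_fun setT h ->
  (forall x, 0 <= g x) -> (forall x, 0 <= h x) ->
  (\int[(m1 \x m2) \x m3]_p (tens g h p)%:E =
   \int[m1]_x (g x)%:E * \int[m2 \x m3]_q (h q)%:E)%E.
Proof.
move=> mg mh g0 h0.
rewrite [LHS](@fubini_tonelli1 _ _ _ _ R (sigma_finite_prod m1 m2) m3
  (fun p => (tens g h p)%:E)); last 2 first.
- by apply/measurable_EFinP; exact: measurable_tens.
- by move=> p; rewrite lee_fin mulr_ge0.
rewrite /fubini_F /tens /=.
pose H x2 := (\int[m3]_y (h (x2, y))%:E)%E.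
have mH : measurable_fun setT H.
  apply: (measurable_fun_fubini_tonelli_F (fun q => (h q)%:E)) => //.
  exact/measurable_EFinP.
have H0 x2 : (0 <= H x2)%E by apply: integral_ge0 => y _; rewrite lee_fin; exact: h0.
under eq_integral => q _.
  under eq_integral do rewrite EFinM.
  rewrite ge0_integralZl_EFin //; last 2 first.
  - by move=> y _; rewrite lee_fin; exact: h0.
  - apply/measurable_EFinP; apply: (measurableT_comp mh).
    by apply: measurable_fun_pair => //; exact: measurable_cst.
  rewrite -/(H q.2).
  over.
rewrite [LHS](@fubini_tonelli1 _ _ _ _ R m1 m2 (fun q => (g q.1)%:E * H q.2)%E);
  last 2 first.
- apply: emeasurable_funM.
  + by apply/measurable_EFinP; apply: (measurableT_comp mg); exact: measurable_fst.
  + by apply: (measurableT_comp mH); exact: measurable_snd.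
- by move=> q; rewrite mule_ge0 // lee_fin; exact: g0.
rewrite /fubini_F /=.
under eq_integral => x _.
  rewrite ge0_integralZl_EFin //.
  over.
rewrite ge0_integralZr //; last 3 first.
- exact/measurable_EFinP.
- by move=> x _; rewrite lee_fin; exact: g0.
- exact: integral_ge0.
by congr (_ * _)%E; rewrite fubini_tonelli1 //; exact/measurable_EFinP.
Qed.

Let ge0_tens g h : m1.-integrable setT (EFin \o g) ->
  (m2 \x m3)%E.-integrable setT (EFin \o h) ->
  (forall x, 0 <= g x) -> (forall x, 0 <= h x) ->
  ((m1 \x m2) \x m3)%E.-integrable setT (EFin \o tens g h) /\
  \int[((m1 \x m2) \x m3)%E]_p tens g h p = \int[m1]_x g x * \int[(m2 \x m3)%E]_q h q.
Proof.
move=> ig ih g0 h0.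
have mg : measurable_fun setT g by apply/measurable_EFinP; exact: measurable_int ig.
have mh : measurable_fun setT h by apply/measurable_EFinP; exact: measurable_int ih.
have fg := integrable_fin_num measurableT ig.
have fh := integrable_fin_num measurableT ih.
have E := ge0_integral_tens mg mh g0 h0.
split; last by rewrite /Rintegral E fineM.
apply/integrableP; split; first by apply/measurable_EFinP; exact: measurable_tens.
under eq_integral => p _.
  rewrite gee0_abs; last by rewrite lee_fin mulr_ge0.
  over.
by rewrite E ltey_eq fin_numM.
Qed.

(** Splitting both factors into positive and negative parts gives four nonnegative tensors, to which
    Tonelli applies. *)
Lemma integral_tens g h : m1.-integrable setT (EFin \o g) ->
  (m2 \x m3)%E.-integrable setT (EFin \o h) ->
  ((m1 \x m2) \x m3)%E.-integrable setT (EFin \o tens g h) /\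
  \int[((m1 \x m2) \x m3)%E]_p tens g h p = \int[m1]_x g x * \int[(m2 \x m3)%E]_q h q.
Proof.
move=> ig ih.
have igp := integrable_funrpos measurableT ig.
have ign := integrable_funrneg measurableT ig.
have ihp := integrable_funrpos measurableT ih.
have ihn := integrable_funrneg measurableT ih.
have [i1 e1] := ge0_tens igp ihp (funrpos_ge0 _) (funrpos_ge0 _).
have [i2 e2] := ge0_tens igp ihn (funrpos_ge0 _) (funrneg_ge0 _).
have [i3 e3] := ge0_tens ign ihp (funrneg_ge0 _) (funrpos_ge0 _).
have [i4 e4] := ge0_tens ign ihn (funrneg_ge0 _) (funrneg_ge0 _).
have tE p : tens g h p = (tens g^\+ h^\+ p + tens g^\- h^\- p)
                       - (tens g^\+ h^\- p + tens g^\- h^\+ p).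
  rewrite /tens -[in LHS](funrposBneg g) -[in LHS](funrposBneg h) /=.
  by rewrite !fctE; ring.
have i14 := integrableD measurableT i1 i4.
have i23 := integrableD measurableT i2 i3.
split.
  apply: eq_integrable (integrableB measurableT i14 i23) => // p _.
  by rewrite /= tE.
under eq_Rintegral do rewrite tE.
rewrite RintegralB // !RintegralD // e1 e2 e3 e4.
have -> : \int[m1]_x g x = \int[m1]_x g^\+ x - \int[m1]_x g^\- x.
  by rewrite -RintegralB //; apply: eq_Rintegral => x _; rewrite -[in LHS](funrposBneg g).
have -> : \int[(m2 \x m3)%E]_x h x = \int[(m2 \x m3)%E]_x h^\+ x - \int[(m2 \x m3)%E]_x h^\- x.
  by rewrite -RintegralB //; apply: eq_Rintegral => x _; rewrite -[in LHS](funrposBneg h).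
ring.
Qed.

Lemma Cintegral_tens (g : T1 -> R[i]) (h : T2 * T3 -> R[i]) :
  Cintegrable m1 g -> Cintegrable (m2 \x m3)%E h ->
  Cintegrable ((m1 \x m2) \x m3)%E (fun p => g p.1.1 * h (p.1.2, p.2)) /\
  Cintegral ((m1 \x m2) \x m3)%E (fun p => g p.1.1 * h (p.1.2, p.2)) =
  Cintegral m1 g * Cintegral (m2 \x m3)%E h.
Proof.
move=> [g1 g2] [h1 h2].
have [i1 e1] := integral_tens g1 h1.
have [i2 e2] := integral_tens g2 h2.
have [i3 e3] := integral_tens g1 h2.
have [i4 e4] := integral_tens g2 h1.
split.
  split.
  - apply: eq_integrable (integrableB measurableT i1 i2) => // p _.
    by rewrite /= cReM EFinB.
  - apply: eq_integrable (integrableD measurableT i3 i4) => // p _.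
    by rewrite /= cImM EFinD.
rewrite /Cintegral.
under eq_Rintegral do rewrite cReM.
under [X in Complex _ X]eq_Rintegral do rewrite cImM.
rewrite RintegralB ?RintegralD //.
by rewrite -/(tens _ _) /= e1 e2 e3 e4.
Qed.

End ProductIntegral.

(** * Derivatives and integrals on the line *)

Section RealDerivative.
Variable R : realType.
Implicit Types (f g : R -> R) (x a b : R).

Definition has_deriv f x a : Prop := is_derive x (1 : R) f a.

Lemma has_derivP f x a : has_deriv f x a -> derivable f x 1 /\ 'D_1 f x = a.
Proof. by case. Qed.

Lemma has_derivD f g x a b : has_deriv f x a -> has_deriv g x b ->
  has_deriv (fun y => f y + g y) x (a + b).
Proof. by move=> fa gb; exact: is_deriveD. Qed.

Lemma has_derivB f g x a b : has_deriv f x a -> has_deriv g x b ->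
  has_deriv (fun y => f y - g y) x (a - b).
Proof. by move=> fa gb; exact: is_deriveB. Qed.

Lemma has_derivM f g x a b : has_deriv f x a -> has_deriv g x b ->
  has_deriv (fun y => f y * g y) x (a * g x + f x * b).
Proof.
move=> fa gb; apply: (is_derive_eq (is_deriveM fa gb)).
by rewrite addrC; congr (_ + _); exact: mulrC.
Qed.

Lemma has_deriv_cst a x : has_deriv (fun _ => a) x 0.
Proof. exact: is_derive_cst. Qed.

Lemma has_deriv_id x : has_deriv (fun y => y) x 1.
Proof. exact: is_derive_id. Qed.

Lemma has_derivV f x a : f x != 0 -> has_deriv f x a ->
  has_deriv (fun y => (f y)^-1) x (- (a / f x ^+ 2)).
Proof.
move=> fx /has_derivP[fd fE]; apply: DeriveDef; first exact: derivableV.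
by rewrite deriveV // fE scaleNr mulrC.
Qed.

Lemma has_deriv_comp f g x a b : has_deriv f x a -> has_deriv g (f x) b ->
  has_deriv (fun y => g (f y)) x (b * a).
Proof.
move=> /has_derivP[fd fE] /has_derivP[gd gE].
apply: DeriveDef.
  apply/derivable1_diffP; apply: (@differentiable_comp _ _ _ _ f g).
    exact/derivable1_diffP.
  exact/derivable1_diffP.
by rewrite -derive1E (derive1_comp fd gd) !derive1E fE gE.
Qed.

Lemma has_deriv_eq f g x a b : (forall y, f y = g y) -> a = b ->
  has_deriv f x a -> has_deriv g x b.
Proof. by move=> /funext -> ->. Qed.

Lemma has_derivX f n x a : has_deriv f x a ->
  has_deriv (fun y => f y ^+ n) x (n%:R * f x ^+ n.-1 * a).
Proof.
move=> fa; elim: n => [|n ih].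
  by apply: has_deriv_eq (has_deriv_cst 1 x) => //; rewrite !mul0r.
apply: has_deriv_eq (has_derivM fa ih) => [y|]; first by rewrite exprS.
by case: n {ih} => [|n] /=; rewrite ?expr0 ?mulr1 -1?[in RHS]natr1 ?[f x ^+ n.+1]exprS; ring.
Qed.

Lemma has_deriv_continuous f x a : has_deriv f x a -> {for x, continuous f}.
Proof.
by move=> /has_derivP[fd _]; apply: differentiable_continuous; exact/derivable1_diffP.
Qed.

End RealDerivative.

Section RealLine.
Variable R : realType.
Local Notation leb := (@lebesgue_measure R).
Implicit Types (f F : R -> R).

Lemma ge0_even_integralT f F (l : R) : (forall x, 0 <= f x) ->
  continuous f -> (forall x, f (- x) = f x) ->
  (forall x, has_deriv F x (f x)) -> F 0 = 0 -> F x @[x --> +oo%R] --> l ->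
  (\int[leb]_x (f x)%:E = (2 * l)%:E)%E.
Proof.
move=> f0 cf fe dF F0 Fl.
rewrite ge0_symfun_integralT //; last by move=> x /=; rewrite fe.
rewrite -set_itvcy (ge0_continuous_FTC2y _ _ Fl) //=.
- by rewrite F0 oppr0 adde0 -EFinM.
- apply/continuous_within_itvcyP; split => [x _|]; first exact: cf.
  by apply: cvg_at_right_filter; exact: cf.
- by move=> x _; have /has_derivP[] := dF x.
- by apply: cvg_at_right_filter; exact: has_deriv_continuous (dF _).
- by move=> x _; rewrite derive1E; have /has_derivP[] := dF x.
Qed.

Lemma integral_sqrDV (a : R) : 0 < a ->
  (\int[leb]_x (((a ^+ 2 + x ^+ 2) ^+ 2)^-1)%:E = (pi / 2 * a ^- 3)%:E)%E.
Proof.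
move=> a0.
have an0 : a != 0 by rewrite gt_eqF.
have pos x : 0 < a ^+ 2 + x ^+ 2 by rewrite ltr_pwDl ?exprn_gt0 // sqr_ge0.
pose th (x : R) := atan (x / a).
(* Substituting x = a tan(theta) turns the integrand into a^-3 cos^2(theta) d theta; this is its
   primitive. *)
pose F x := (2 * a ^+ 3)^-1 * (sin (th x) * cos (th x) + th x).
have dth x : has_deriv th x ((1 + (x / a) ^+ 2)^-1 * (1 * a^-1 + x * 0)).
  apply: has_deriv_comp; last exact: is_derive1_atan.
  by apply: has_derivM; [exact: has_deriv_id|exact: has_deriv_cst].
pose dt x := (1 + (x / a) ^+ 2)^-1 * (1 * a^-1 + x * 0).
have ds x : has_deriv (fun x => sin (th x)) x (cos (th x) * dt x).
  by apply: has_deriv_comp (dth x) _; exact: is_derive_sin.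
have dc x : has_deriv (fun x => cos (th x)) x (- sin (th x) * dt x).
  by apply: has_deriv_comp (dth x) _; exact: is_derive_cos.
have dq : continuous (fun x : R => ((a ^+ 2 + x ^+ 2) ^+ 2)^-1).
  move=> x; apply: has_deriv_continuous.
  apply: has_derivV; first by rewrite expf_neq0 // gt_eqF.
  apply: has_derivX; apply: has_derivD; first exact: has_deriv_cst.
  by apply: has_derivX; exact: has_deriv_id.
have dF x : has_deriv F x ((a ^+ 2 + x ^+ 2) ^+ 2)^-1.
  apply: has_deriv_eq (has_derivM (has_deriv_cst _ _)
    (has_derivD (has_derivM (ds x) (dc x)) (dth x))) => //.
  have c2 : cos (th x) ^+ 2 = (1 + (x / a) ^+ 2)^-1.
    by rewrite /th cos_atan exprVn sqr_sqrtr // addr_ge0 // sqr_ge0.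
  have s2 : sin (th x) ^+ 2 = 1 - (1 + (x / a) ^+ 2)^-1 by rewrite sin2cos2 c2.
  rewrite /dt mul0r add0r mul1r mulr0 addr0.
  set q := (1 + (x / a) ^+ 2)^-1 in c2 s2 *.
  transitivity ((2 * a ^+ 3)^-1 * (q * a^-1 * (cos (th x) ^+ 2 - sin (th x) ^+ 2 + 1))).
    by ring.
  have qE : q = a ^+ 2 / (a ^+ 2 + x ^+ 2).
    rewrite /q; field; rewrite an0 /= gt_eqF ?pos //.
  by rewrite c2 s2 qE; field; rewrite an0 gt_eqF ?pos.
rewrite (@ge0_even_integralT _ F ((2 * a ^+ 3)^-1 * (sin (pi / 2) * cos (pi / 2) + pi / 2))) //.
- by rewrite cos_pihalf mulr0 add0r; congr EFin; field.
- by move=> x; rewrite invr_ge0 sqr_ge0.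
- by move=> x; rewrite sqrrN.
- by rewrite /F /th mul0r atan0 sin0 mul0r addr0 mulr0.
- have cth : th x @[x --> +oo] --> pi / 2.
    apply: (cvg_comp (fun x => x / a) atan); last exact: cvgy_atan.
    by apply: gt0_cvgMly; [rewrite invr_gt0|exact: cvg_id].
  apply: cvgM; first exact: cvg_cst.
  apply: cvgD => //; apply: cvgM.
  + by apply: (cvg_comp th sin); [exact: cth|exact: continuous_sin].
  + by apply: (cvg_comp th cos); [exact: cth|exact: continuous_cos].
Qed.

(** The integrand is (1 + y^2)^(-3/2) in a form free of fractional powers, with primitive sin(atan
    y). It is the outer integral in [integral_base]. *)
Lemma integral_cos_atan :
  (\int[leb]_y (cos (atan y) * (1 + y ^+ 2)^-1)%:E = 2%:E)%E.
Proof.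
have p1 (y : R) : 1 + y ^+ 2 != 0 by rewrite gt_eqF // ltr_pwDl // sqr_ge0.
have dc y : has_deriv (fun x : R => cos (atan x)) y (- sin (atan y) * (1 + y ^+ 2)^-1).
  by apply: has_deriv_comp (is_derive1_atan y) _; exact: is_derive_cos.
have cv : continuous (fun y : R => (1 + y ^+ 2)^-1).
  move=> y; apply: has_deriv_continuous.
  apply: has_derivV; first exact: p1.
  apply: has_derivD; first exact: has_deriv_cst.
  by apply: has_derivX; exact: has_deriv_id.
rewrite (@ge0_even_integralT _ (fun y => sin (atan y)) (sin (pi / 2))).
- by rewrite sin_pihalf mulr1.
- move=> y; rewrite mulr_ge0 ?invr_ge0 ?addr_ge0 ?sqr_ge0 //.
  by rewrite cos_atan invr_ge0 sqrtr_ge0.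
- by move=> y; apply: cvgM; [exact: has_deriv_continuous (dc y)|exact: cv].
- by move=> y; rewrite atanN cosN sqrrN.
- by move=> y; apply: has_deriv_comp (is_derive1_atan y) _; exact: is_derive_sin.
- by rewrite atan0 sin0.
- apply: (cvg_comp atan sin); first exact: cvgy_atan.
  exact: continuous_sin.
Qed.

(** The bound forces |F(x)| <= 1/|x| away from 0, so the boundary terms on growing symmetric
    intervals vanish; dominated convergence passes to the whole line. *)
Lemma integral_derive0 f F : (forall x, has_deriv F x (f x)) -> continuous f ->
  leb.-integrable setT (EFin \o f) ->
  (forall x, F x ^+ 2 * (1 + x ^+ 2) <= 1) ->
  (\int[leb]_x (f x)%:E = 0)%E.
Proof.
move=> dF cf If bF.
pose S n := `[- (n.+1%:R : R), n.+1%:R]%classic.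
have mf : measurable_fun setT (EFin \o f) by exact: measurable_int If.
have c1 : (\int[leb]_x ((EFin \o f) \_ (S n)) x)%E @[n --> \oo] -->
          (\int[leb]_x (f x)%:E)%E.
  apply: (@dominated_cvg _ _ _ leb setT measurableT (fun n => (EFin \o f) \_ (S n))
    (EFin \o f) (abse \o (EFin \o f))) => //.
  - move=> n; apply/measurable_restrict => //; first exact: measurable_itv.
    by apply: measurable_funS mf.
  - move=> x _; apply: cvg_near_cst.
    near=> n; rewrite /= patchE mem_set // /S /= in_itv /= -ler_norml.
    apply: ltW; apply: lt_le_trans (_ : (n%:R : R) <= _); last by rewrite ler_nat.
    near: n; exact: nbhs_infty_gtr.
  - exact: integrable_abse.
  - move=> n x _ /=; rewrite patchE; case: ifP => // _.
    by rewrite abse0 lee_fin normr_ge0.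
have sE n : (\int[leb]_x ((EFin \o f) \_ (S n)) x = (F n.+1%:R - F (- n.+1%:R))%:E)%E.
  rewrite -integral_mkcond (@continuous_FTC2 _ f F) //.
  - by rewrite -subr_gt0 opprK -natrD ltr0n.
  - by apply: continuous_subspaceT => x; exact: cf.
  - split.
    + by move=> x _; have /has_derivP[] := dF x.
    + by apply: cvg_at_right_filter; exact: has_deriv_continuous (dF _).
    + by apply: cvg_at_left_filter; exact: has_deriv_continuous (dF _).
  - by move=> x _; rewrite derive1E; have /has_derivP[] := dF x.
have bnd (x : R) n : x ^+ 2 = n.+1%:R ^+ 2 -> `|F x| <= n.+1%:R^-1.
  move=> xE; rewrite -ler_sqr ?nnegrE ?invr_ge0 ?normr_ge0 //.
  rewrite real_normK ?num_real // exprVn.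
  have n0 : 0 < n.+1%:R ^+ 2 :> R by rewrite exprn_gt0.
  rewrite -[_^-1]mul1r ler_pdivlMr //.
  apply: le_trans (bF x); rewrite ler_wpM2l ?sqr_ge0 // xE.
  by rewrite lerDr.
have c2 : (\int[leb]_x ((EFin \o f) \_ (S n)) x)%E @[n --> \oo] --> (0 : \bar R).
  under eq_fun do rewrite sE.
  apply: cvg_EFin; first by near=> n.
  rewrite /comp /=.
  have c0 (G : nat -> R) : (forall n, `|G n| <= n.+1%:R^-1) -> G n @[n --> \oo] --> (0 : R).
    move=> bG; apply: norm_cvg0; apply: squeeze_cvgr (cvg_cst 0) cvg_harmonic.
    by near=> n; rewrite normr_ge0 bG.
  rewrite -[0]subr0; apply: cvgB; apply: c0 => n; apply: bnd => //.
  by rewrite sqrrN.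
exact: cvg_unique c1 c2.
Unshelve. all: by end_near. Qed.

End RealLine.

(** * Moments on the plane *)

Section Plane.
Variable R : realType.
Local Notation leb := (@lebesgue_measure R).

(** Fubini reduces to horizontal lines. Integrability is inherited by almost every section, and on
    those the inner integral is zero by [integral_derive0]. *)
Lemma integral_dx0 (f F : R * R -> R) :
  (forall x y, has_deriv (fun t => F (t, y)) x (f (x, y))) ->
  (forall y, continuous (fun x => f (x, y))) ->
  (lebC R).-integrable setT (EFin \o f) ->
  (forall x y, F (x, y) ^+ 2 * (1 + x ^+ 2) <= 1) ->
  \int[lebC R]_p f p = 0.
Proof.
move=> dF cf If bF; rewrite /Rintegral -[X in fine X](integral21_prod_meas1 If).
have mG := measurable_fubini_G If.
rewrite (@ae_eq_integral _ _ _ leb setT (cst 0)) ?integral0 //.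
have := ae_integrable2 If; apply: filterS => y iy _ /=.
exact: (@integral_derive0 _ _ (fun t => F (t, y))).
Qed.

Lemma integral_dy0 (f F : R * R -> R) :
  (forall x y, has_deriv (fun t => F (x, t)) y (f (x, y))) ->
  (forall x, continuous (fun y => f (x, y))) ->
  (lebC R).-integrable setT (EFin \o f) ->
  (forall x y, F (x, y) ^+ 2 * (1 + y ^+ 2) <= 1) ->
  \int[lebC R]_p f p = 0.
Proof.
move=> dF cf If bF; rewrite /Rintegral -[X in fine X](integral12_prod_meas1 If).
have mG := measurable_fubini_F If.
rewrite (@ae_eq_integral _ _ _ leb setT (cst 0)) ?integral0 //.
have := ae_integrable1 If; apply: filterS => x ix _ /=.
exact: (@integral_derive0 _ _ (fun t => F (x, t))).
Qed.

Definition zpt (p : R * R) : R[i] := Complex p.1 p.2.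

Lemma Cmeas_zpt : Cmeas zpt.
Proof. by split; [exact: measurable_fst|exact: measurable_snd]. Qed.

Lemma oneDabs2_gt0 (z : R[i]) : 0 < 1 + abs2 z.
Proof. by rewrite ltr_pwDl // abs2_ge0. Qed.

Lemma oneDabs2_ge1 (z : R[i]) : 1 <= 1 + abs2 z.
Proof. by rewrite lerDl abs2_ge0. Qed.

Lemma measurable_abs2 d (T : measurableType d) (g : T -> R[i]) : Cmeas g ->
  measurable_fun setT (fun x => abs2 (g x)).
Proof. by move=> [g1 g2]; apply: measurable_funD; exact: measurable_funX. Qed.

Lemma measurable_oneDabs2V d (T : measurableType d) (g : T -> R[i]) n : Cmeas g ->
  measurable_fun setT (fun x => (1 + abs2 (g x)) ^- n).
Proof.
move=> mg; under eq_fun do rewrite -exprVn.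
apply: measurable_funX.
(* The absolute value makes the reciprocal continuous on the whole line; it disappears on the values
   of [abs2]. *)
pose phi (t : R) := (1 + `|t|)^-1.
have cphi : continuous phi.
  move=> t; apply: cvgV; first by rewrite gt_eqF // ltr_pwDl.
  by apply: cvgD; [exact: cvg_cst|exact: norm_continuous].
have -> : (fun x => (1 + abs2 (g x))^-1) = phi \o (fun x => abs2 (g x)).
  by apply/funext => x; rewrite /phi /= ger0_norm // abs2_ge0.
apply: measurableT_comp; first exact: continuous_measurable_fun.
exact: measurable_abs2.
Qed.

Lemma integral_base : (\int[lebC R]_p ((1 + abs2 (zpt p)) ^- 2)%:E = (pi : R)%:E)%E.
Proof.
rewrite fubini_tonelli1; last 2 first.
- by apply/measurable_EFinP; exact: (measurable_oneDabs2V 2 Cmeas_zpt).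
- by move=> p; rewrite lee_fin invr_ge0 sqr_ge0.
under eq_integral => x _.
  rewrite /fubini_F /zpt /abs2 /cRe /cIm /=.
  have c0 : 0 < cos (atan x).
    by rewrite cos_atan invr_gt0 sqrtr_gt0 ltr_pwDl // sqr_ge0.
  (* Here 1 / cos(atan x) plays the role of a = sqrt(1 + x^2) in [integral_sqrDV]. *)
  have c2 : cos (atan x) ^- 2 = 1 + x ^+ 2.
    by rewrite cos_atan exprVn invrK sqr_sqrtr // addr_ge0 // sqr_ge0.
  under eq_integral do rewrite addrA -c2 -(exprVn (cos (atan x))).
  rewrite integral_sqrDV ?invr_gt0 // exprVn invrK.
  rewrite exprS -(invrK (cos (atan x) ^+ 2)) c2 EFinM.
  over.
rewrite ge0_integralZl_EFin ?integral_cos_atan //=; last 3 first.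
- move=> x _; rewrite lee_fin mulr_ge0 ?invr_ge0 ?addr_ge0 ?sqr_ge0 //.
  by rewrite cos_atan invr_ge0 sqrtr_ge0.
- apply/measurable_EFinP; apply: continuous_measurable_fun => x.
  apply: cvgM; last exact: continuous_oneDsqrV.
  apply: (cvg_comp atan cos); first exact: continuous_atan.
  exact: continuous_cos.
- by rewrite divr_ge0 // pi_ge0.
by rewrite -EFinM mulfVK.
Qed.

Lemma integrable_base : (lebC R).-integrable setT (fun p => ((1 + abs2 (zpt p)) ^- 2)%:E).
Proof.
apply/integrableP; split.
  by apply/measurable_EFinP; exact: (measurable_oneDabs2V 2 Cmeas_zpt).
under eq_integral => p _ do rewrite gee0_abs ?lee_fin ?invr_ge0 ?sqr_ge0 //.
by rewrite integral_base ltry.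
Qed.

(** The linear span of this family is closed under real partial derivatives, so integration by parts
    becomes a recurrence among moments. *)
Definition zmon a b n (z : R[i]) : R[i] := z ^+ a * cconj z ^+ b * cR ((1 + abs2 z) ^- n).

Lemma abs2_zmon a b n z : abs2 (zmon a b n z) = abs2 z ^+ (a + b) * ((1 + abs2 z) ^- n) ^+ 2.
Proof. by rewrite /zmon !abs2M !abs2X abs2_conj abs2_cR exprD. Qed.

Lemma Cmeas_zmon d (T : measurableType d) (g : T -> R[i]) a b n : Cmeas g ->
  Cmeas (fun x => zmon a b n (g x)).
Proof.
move=> mg; apply: CmeasM; last exact/Cmeas_cR/measurable_oneDabs2V.
by apply: CmeasM; apply: CmeasX => //; exact: Cmeas_conj.
Qed.

(** Used with m = 4 to dominate by the square of the integrand of [integral_base], and with m = 1 to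
    make boundary terms decay. *)
Lemma abs2_zmon_le a b n m z : (a + b + m <= 2 * n)%N ->
  abs2 (zmon a b n z) <= (1 + abs2 z) ^- m.
Proof.
move=> h; rewrite abs2_zmon; have p0 := oneDabs2_gt0 z; have p1 := oneDabs2_ge1 z.
rewrite -exprVn -exprM exprVn ler_pdivrMr ?exprn_gt0 // mulrC.
rewrite ler_pdivlMr ?exprn_gt0 //.
apply: (@le_trans _ _ ((1 + abs2 z) ^+ (a + b) * (1 + abs2 z) ^+ m)).
  apply: ler_wpM2r; first by rewrite exprn_ge0 // ltW.
  by apply: lerXn2r; rewrite ?nnegrE ?abs2_ge0 ?(ltW p0) // lerDr.
by rewrite -exprD; apply: ler_weXn2l => //; lia.
Qed.

Lemma Cintegrable_zmon a b n : (a + b + 4 <= 2 * n)%N ->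
  Cintegrable (lebC R) (fun p => zmon a b n (zpt p)).
Proof.
move=> h; apply: le_Cintegrable integrable_base.
- exact/Cmeas_zmon/Cmeas_zpt.
- by move=> p; rewrite invr_ge0 sqr_ge0.
- by move=> p; rewrite -exprVn -exprM exprVn; exact: abs2_zmon_le.
Qed.

Definition moment a b n : R[i] := Cintegral (lebC R) (fun p => zmon a b n (zpt p)).

End Plane.

(** * Derivatives of complex-valued functions of a real variable *)

Section ComplexDerivative.
Variable R : realType.
Implicit Types (H K : R -> R[i]) (x : R) (c e : R[i]).

Definition has_cderiv H x c : Prop :=
  has_deriv (fun t => cRe (H t)) x (cRe c) /\ has_deriv (fun t => cIm (H t)) x (cIm c).

Lemma has_cderiv_eq H K x c e : (forall y, H y = K y) -> c = e ->
  has_cderiv H x c -> has_cderiv K x e.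
Proof. by move=> /funext -> ->. Qed.

Lemma has_cderivD H K x c e : has_cderiv H x c -> has_cderiv K x e ->
  has_cderiv (fun t => H t + K t) x (c + e).
Proof.
move=> [h1 h2] [k1 k2]; split.
- by apply: has_deriv_eq (has_derivD h1 k1) => [y|]; rewrite cReD.
- by apply: has_deriv_eq (has_derivD h2 k2) => [y|]; rewrite cImD.
Qed.

Lemma has_cderivM H K x c e : has_cderiv H x c -> has_cderiv K x e ->
  has_cderiv (fun t => H t * K t) x (c * K x + H x * e).
Proof.
move=> [h1 h2] [k1 k2]; split.
- apply: has_deriv_eq (has_derivB (has_derivM h1 k1) (has_derivM h2 k2)) => [y|].
    by rewrite cReM.
  by rewrite cReD !cReM; ring.
- apply: has_deriv_eq (has_derivD (has_derivM h1 k2) (has_derivM h2 k1)) => [y|].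
    by rewrite cImM.
  by rewrite cImD !cImM; ring.
Qed.

Lemma has_cderiv_cst c x : has_cderiv (fun _ => c) x 0.
Proof. by split; exact: has_deriv_cst. Qed.

Lemma has_cderivX H n x c : has_cderiv H x c ->
  has_cderiv (fun t => H t ^+ n) x (n%:R * H x ^+ n.-1 * c).
Proof.
move=> fa; elim: n => [|n ih].
  by apply: has_cderiv_eq (has_cderiv_cst 1 x) => //; rewrite !mul0r.
apply: has_cderiv_eq (has_cderivM fa ih) => [y|]; first by rewrite exprS.
by case: n {ih} => [|n] /=; rewrite ?expr0 ?mulr1 -1?[in RHS]natr1 ?[H x ^+ n.+1]exprS; ring.
Qed.

Lemma has_cderiv_conj H x c : has_cderiv H x c ->
  has_cderiv (fun t => cconj (H t)) x (cconj c).
Proof.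
move=> [h1 h2]; split => //.
apply: has_deriv_eq (has_derivB (has_deriv_cst 0 x) h2) => [y|]; exact: sub0r.
Qed.

Lemma has_cderiv_cR (u : R -> R) x a : has_deriv u x a ->
  has_cderiv (fun t => cR (u t)) x (cR a).
Proof. by move=> h; split => //; exact: has_deriv_cst. Qed.

(** The derivative of [zmon a b n] along [e], that is, e times d/dz plus the conjugate of e times
    d/dz^-. If [a] or [b] is 0, the truncated predecessor is harmless because its coefficient is
    0. *)
Definition dzmon e a b n (z : R[i]) : R[i] :=
  e * (a%:R * zmon a.-1 b n z) + cconj e * (b%:R * zmon a b.-1 n z)
  - n%:R * (cconj e * zmon a.+1 b n.+1 z + e * zmon a b.+1 n.+1 z).

Lemma has_cderiv_zmon H x e a b n : has_cderiv H x e ->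
  has_cderiv (fun t => zmon a b n (H t)) x (dzmon e a b n (H x)).
Proof.
move=> dH; have [h1 h2] := dH.
have p0 := oneDabs2_gt0 (H x).
pose s := 2 * (cRe (H x) * cRe e + cIm (H x) * cIm e).
have ds : has_deriv (fun t => 1 + abs2 (H t)) x s.
  apply: has_deriv_eq (has_derivD (has_deriv_cst 1 x)
    (has_derivD (has_derivX 2 h1) (has_derivX 2 h2))) => //.
  by rewrite /s /=; ring.
have dv : has_deriv (fun t => (1 + abs2 (H t)) ^- n) x (- (n%:R * s * (1 + abs2 (H x)) ^- n.+1)).
  apply: has_deriv_eq (has_derivV _ (has_derivX n ds)) => //; last first.
    by rewrite expf_neq0 // gt_eqF.
  case: n => [|n] /=; first by rewrite !mul0r.
  have p1 : 1 + abs2 (H x) != 0 by rewrite gt_eqF.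
  have pn : (1 + abs2 (H x)) ^+ n != 0 by rewrite expf_neq0.
  by rewrite !exprS; field; rewrite ?p1 ?pn.
have sE : cR s = cconj e * H x + e * cconj (H x).
  apply/eqP; rewrite eq_complex /s; case: (H x) => u v; case: (e) => c d.
  by rewrite /cconj /cRe /cIm /=; apply/andP; split; apply/eqP; ring.
clearbody s.
apply: has_cderiv_eq (has_cderivM (has_cderivM (has_cderivX a dH)
   (has_cderivX b (has_cderiv_conj dH))) (has_cderiv_cR dv)) => //.
rewrite /dzmon /zmon rmorphN !rmorphM rmorph_nat /= sE [_ ^+ a.+1]exprS [_ ^+ b.+1]exprS.
ring.
Qed.

(** Existence of a second derivative gives continuity of the first, which the fundamental theorem of
    calculus requires; its value stays unspecified. *)
Lemma has_cderiv_dzmon H x e a b n : has_cderiv H x e ->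
  exists c, has_cderiv (fun t => dzmon e a b n (H t)) x c.
Proof.
move=> dH; have dZ i j m := has_cderiv_zmon i j m dH.
have dC c := has_cderiv_cst c x.
eexists.
apply: has_cderiv_eq (has_cderivD (has_cderivD
   (has_cderivM (dC e) (has_cderivM (dC a%:R) (dZ a.-1 b n)))
   (has_cderivM (dC (cconj e)) (has_cderivM (dC b%:R) (dZ a b.-1 n))))
   (has_cderivM (dC (- n%:R)) (has_cderivD (has_cderivM (dC (cconj e)) (dZ a.+1 b n.+1))
      (has_cderivM (dC e) (dZ a b.+1 n.+1))))); last by reflexivity.
by move=> t; rewrite mulNr.
Qed.

End ComplexDerivative.

(** * Recurrences and values of the moments *)

Section Moments.
Variable R : realType.
Implicit Types (e : R[i]).

(** For a = 0 or b = 0 the function [zmon] itself may fail the integrability bound, but its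
    coefficient is 0; hence the coefficient stays inside the integral. *)
Let mzmon a b n : (a + b + 3 <= 2 * n)%N ->
  Cintegrable (lebC R) (fun p => a%:R * zmon a.-1 b n (zpt p)) /\
  Cintegrable (lebC R) (fun p => b%:R * zmon a b.-1 n (zpt p)).
Proof.
move=> h; split.
- case: a h => [|a] h; last by apply/CintegrableZ/Cintegrable_zmon; lia.
  by under eq_fun do rewrite mul0r; exact: Cintegrable0.
- case: b h => [|b] h; last by apply/CintegrableZ/Cintegrable_zmon; lia.
  by under eq_fun do rewrite mul0r; exact: Cintegrable0.
Qed.

Let dzmon_integral e a b n : (a + b + 3 <= 2 * n)%N ->
  Cintegrable (lebC R) (fun p => dzmon e a b n (zpt p)) /\
  Cintegral (lebC R) (fun p => dzmon e a b n (zpt p)) =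
  e * Cintegral (lebC R) (fun p => a%:R * zmon a.-1 b n (zpt p)) +
  cconj e * Cintegral (lebC R) (fun p => b%:R * zmon a b.-1 n (zpt p)) -
  n%:R * (cconj e * moment R a.+1 b n.+1 + e * moment R a b.+1 n.+1).
Proof.
move=> h; have [i1 i2] := mzmon h.
have i3 : Cintegrable (lebC R) (fun p => zmon a.+1 b n.+1 (zpt p)).
  by apply: Cintegrable_zmon; lia.
have i4 : Cintegrable (lebC R) (fun p => zmon a b.+1 n.+1 (zpt p)).
  by apply: Cintegrable_zmon; lia.
have j12 := CintegrableD (CintegrableZ e i1) (CintegrableZ (cconj e) i2).
have j34 := CintegrableD (CintegrableZ (cconj e) i3) (CintegrableZ e i4).
have j := CintegrableZ (- n%:R) j34.
rewrite /dzmon; under eq_fun do rewrite -mulNr.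
split; first exact: CintegrableD j12 j.
rewrite (CintegralD j12 j) (CintegralZ _ j34) mulNr.
rewrite (CintegralD (CintegrableZ e i1) (CintegrableZ (cconj e) i2)).
rewrite (CintegralD (CintegrableZ (cconj e) i3) (CintegrableZ e i4)).
by rewrite (CintegralZ _ i1) (CintegralZ _ i2) (CintegralZ _ i3) (CintegralZ _ i4).
Qed.

Let bound a b n (z : R[i]) (x : R) : (a + b + 3 <= 2 * n)%N -> x ^+ 2 <= abs2 z ->
  cRe (zmon a b n z) ^+ 2 * (1 + x ^+ 2) <= 1 /\ cIm (zmon a b n z) ^+ 2 * (1 + x ^+ 2) <= 1.
Proof.
move=> h xz; have zle : abs2 (zmon a b n z) * (1 + x ^+ 2) <= 1.
  have := @abs2_zmon_le R a b n 1 z _; rewrite expr1 => /(_ ltac:(lia)) h1.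
  apply: (@le_trans _ _ (abs2 (zmon a b n z) * (1 + abs2 z))).
    by apply: ler_wpM2l; rewrite ?abs2_ge0 // lerD2l.
  by rewrite -ler_pdivlMr ?oneDabs2_gt0 // mul1r.
have p : 0 <= 1 + x ^+ 2 by rewrite addr_ge0 // sqr_ge0.
by split; apply: le_trans zle; apply: ler_wpM2r => //; rewrite /abs2 ?lerDl ?lerDr sqr_ge0.
Qed.

(** The directions 1 and i are the two real coordinate axes; the exponent condition supplies both
    integrability and the decay at infinity. *)
Let dzmon_int0 a b n : (a + b + 3 <= 2 * n)%N ->
  Cintegral (lebC R) (fun p => dzmon 1 a b n (zpt p)) = 0 /\
  Cintegral (lebC R) (fun p => dzmon (Complex 0 1) a b n (zpt p)) = 0.
Proof.
move=> h.
have dx x y : has_cderiv (fun t : R => zpt (t, y)) x 1.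
  by split; [exact: has_deriv_id|exact: has_deriv_cst].
have dy x y : has_cderiv (fun t : R => zpt (x, t)) y (Complex 0 1).
  by split; [exact: has_deriv_cst|exact: has_deriv_id].
have [[i1 i2] _] := @dzmon_integral 1 _ _ _ h.
have [[i3 i4] _] := @dzmon_integral (Complex 0 1) _ _ _ h.
have bx (x y : R) : x ^+ 2 <= abs2 (zpt (x, y)) by rewrite /abs2 /= lerDl sqr_ge0.
have by_ (x y : R) : y ^+ 2 <= abs2 (zpt (x, y)) by rewrite /abs2 /= lerDr sqr_ge0.
split; rewrite /Cintegral.
- rewrite (@integral_dx0 _ _ (fun p => cRe (zmon a b n (zpt p)))) //.
  + rewrite (@integral_dx0 _ _ (fun p => cIm (zmon a b n (zpt p)))) //.
    * by move=> x y; have [_ ] := has_cderiv_zmon a b n (dx x y).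
    * move=> y x; have [c [_ ]] := has_cderiv_dzmon a b n (dx x y).
      exact: has_deriv_continuous.
    * by move=> x y; have [] := bound h (bx x y).
  + by move=> x y; have [] := has_cderiv_zmon a b n (dx x y).
  + move=> y x; have [c [+ _]] := has_cderiv_dzmon a b n (dx x y).
    exact: has_deriv_continuous.
  + by move=> x y; have [] := bound h (bx x y).
- rewrite (@integral_dy0 _ _ (fun p => cRe (zmon a b n (zpt p)))) //.
  + rewrite (@integral_dy0 _ _ (fun p => cIm (zmon a b n (zpt p)))) //.
    * by move=> x y; have [_ ] := has_cderiv_zmon a b n (dy x y).
    * move=> x y; have [c [_ ]] := has_cderiv_dzmon a b n (dy x y).
      exact: has_deriv_continuous.
    * by move=> x y; have [] := bound h (by_ x y).
  + by move=> x y; have [] := has_cderiv_zmon a b n (dy x y).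
  + move=> x y; have [c [+ _]] := has_cderiv_dzmon a b n (dy x y).
    exact: has_deriv_continuous.
  + by move=> x y; have [] := bound h (by_ x y).
Qed.

Let two_neq0 : (2 : R[i]) != 0. Proof. by rewrite pnatr_eq0. Qed.

Let stokes a b n : (a + b + 3 <= 2 * n)%N ->
  Cintegral (lebC R) (fun p => a%:R * zmon a.-1 b n (zpt p)) = n%:R * moment R a b.+1 n.+1 /\
  Cintegral (lebC R) (fun p => b%:R * zmon a b.-1 n (zpt p)) = n%:R * moment R a.+1 b n.+1.
Proof.
move=> h; have [e1 e2] := dzmon_int0 h.
have [_ f1] := @dzmon_integral 1 _ _ _ h; have [_ f2] := @dzmon_integral (Complex 0 1) _ _ _ h.
rewrite e1 in f1; rewrite e2 in f2.
have c1 : cconj 1 = 1 :> R[i] by exact: rmorph1.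
have ci : cconj (Complex 0 1) = - Complex 0 1 :> R[i].
  by apply/eqP; rewrite eq_complex /= oppr0 !eqxx.
have ii : (Complex 0 1 : R[i]) * Complex 0 1 = -1.
  by apply/eqP; rewrite eq_complex /=; apply/andP; split; apply/eqP; ring.
rewrite c1 in f1; rewrite ci in f2.
set A := Cintegral _ (fun p => a%:R * _) in f1 f2 *.
set B := Cintegral _ (fun p => b%:R * _) in f1 f2 *.
set C := moment R a.+1 b n.+1 in f1 f2 *.
set D := moment R a b.+1 n.+1 in f1 f2 *.
(* The equations for the directions 1 and i; their half sum and half difference isolate the
   integrals of d/dz and d/dz^-. *)
have g1 : A + B - n%:R * (C + D) = 0 by rewrite [RHS]f1; ring.
have g2 : A - B - n%:R * (D - C) = 0.
  apply: (@mulfI _ (Complex 0 1)); first by apply/eqP => /eqP; rewrite eq_complex /= oner_eq0 andbF.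
  by rewrite mulr0 [RHS]f2; ring.
split; apply: (mulfI two_neq0); apply/eqP; rewrite -subr_eq0; apply/eqP.
- transitivity ((A + B - n%:R * (C + D)) + (A - B - n%:R * (D - C))); first by ring.
  by rewrite g1 g2 addr0.
- transitivity ((A + B - n%:R * (C + D)) - (A - B - n%:R * (D - C))); first by ring.
  by rewrite g1 g2 subr0.
Qed.

Lemma moment_recz a b n : (a + b + 4 <= 2 * n)%N ->
  b.+1%:R * moment R a b n = n%:R * moment R a.+1 b.+1 n.+1.
Proof.
move=> h; have [|_ <-] := @stokes a b.+1 n; first by lia.
by rewrite CintegralZ //; exact: Cintegrable_zmon.
Qed.

Lemma moment_recc a b n : (a + b + 4 <= 2 * n)%N ->
  a.+1%:R * moment R a b n = n%:R * moment R a.+1 b.+1 n.+1.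
Proof.
move=> h; have [|<- _] := @stokes a.+1 b n; first by lia.
by rewrite CintegralZ //; exact: Cintegrable_zmon.
Qed.

Lemma moment_neq a b n : (a + b + 4 <= 2 * n)%N -> a != b -> moment R a b n = 0.
Proof.
move=> h ab; have := moment_recz h; rewrite -(moment_recc h) => /eqP.
rewrite -subr_eq0 -mulrBl mulf_eq0 => /orP[|/eqP//].
by rewrite subr_eq0 eqr_nat eqSS eq_sym (negbTE ab).
Qed.

Lemma moment00_2 : moment R 0 0 2 = cR pi.
Proof.
rewrite /moment /Cintegral /cR; congr Complex.
- under eq_Rintegral do rewrite /zmon !expr0 !mul1r.
  by rewrite /Rintegral integral_base.
- under eq_Rintegral do rewrite /zmon !expr0 !mul1r.
  by rewrite Rintegral_cst // mul0r.
Qed.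

(** Splitting off a factor 1 + |z|^2 gives M(0, 0, n + 2) = M(0, 0, n + 3) + M(1, 1, n + 3), and the
    recurrence expresses the last term by the left side. *)
Lemma moment00 n : moment R 0 0 n.+2 = cR (pi / n.+1%:R).
Proof.
elim: n => [|n ih]; first by rewrite moment00_2 divr1.
have i0 m : Cintegrable (lebC R) (fun p => zmon 0 0 m.+2 (zpt p)).
  by apply: Cintegrable_zmon; lia.
have i1 : Cintegrable (lebC R) (fun p => zmon 1 1 n.+3 (zpt p)).
  by apply: Cintegrable_zmon; lia.
have E : moment R 0 0 n.+2 = moment R 0 0 n.+3 + moment R 1 1 n.+3.
  rewrite /moment -CintegralD //; congr Cintegral; apply/funext => p.
  have p0 := oneDabs2_gt0 (zpt p).
  rewrite /zmon !expr0 !expr1 !mul1r -cR_abs2 -rmorphM -rmorphD; congr cR.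
  by rewrite [_ ^+ n.+3]exprS; field; rewrite expf_neq0 gt_eqF.
have h := @moment_recz 0 0 n.+2 ltac:(lia); rewrite mul1r in h.
have nz : n.+2%:R != 0 :> R[i] by rewrite pnatr_eq0.
apply: (mulfI nz).
have -> : n.+2%:R * moment R 0 0 n.+3 = n.+1%:R * moment R 0 0 n.+2.
  have -> : moment R 0 0 n.+3 = moment R 0 0 n.+2 - moment R 1 1 n.+3 by rewrite E addrK.
  by rewrite mulrBr -h -natr1 mulrDl mul1r addrK.
rewrite ih -!(rmorph_nat (@cR R)) -!rmorphM; congr cR.
by rewrite [LHS]mulrCA [RHS]mulrCA !divff ?pnatr_eq0.
Qed.

(** The Beta integral pi B(a + 1, n + 1), by induction on [a]. The exponent is written as a + n + 2
    to avoid subtraction. *)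
Lemma momentE a n : moment R a a (a + n).+2 = cR (pi * (a`! * n`!)%:R / (a + n).+1`!%:R).
Proof.
elim: a => [|a ih].
  rewrite add0n moment00 mul1n factS natrM; congr cR.
  have F0 : n`!%:R != 0 :> R by rewrite pnatr_eq0 -lt0n fact_gt0.
  by rewrite [n.+1%:R * _]mulrC invfM mulrA mulfK.
have nz : (a + n).+2%:R != 0 :> R[i] by rewrite pnatr_eq0.
apply: (mulfI nz); rewrite addSn -moment_recz; last by lia.
rewrite ih -!(rmorph_nat (@cR R)) -!rmorphM; congr cR.
have e1 : (a + n).+2`!%:R = (a + n).+2%:R * (a + n).+1`!%:R :> R by rewrite factS natrM.
have e2 : (a.+1`! * n`!)%:R = a.+1%:R * (a`! * n`!)%:R :> R by rewrite factS -mulnA natrM.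
rewrite e1 e2.
have N0 : (a + n).+2%:R != 0 :> R by rewrite pnatr_eq0.
have F0 : (a + n).+1`!%:R != 0 :> R by rewrite pnatr_eq0 -lt0n fact_gt0.
move: (_ .+2%:R) (_ .+1`!%:R) (a.+1%:R) (_ * _)%:R N0 F0 => N F A B N0 F0.
by field; rewrite N0 F0.
Qed.

End Moments.

(** * Continuous functions on the sphere *)

Section PlaneContinuity.
Variable R : realType.

Definition plane_continuous (u : R * R -> R) := forall p (e : R), 0 < e ->
  exists2 d : R, 0 < d & forall q, `|q.1 - p.1| < d -> `|q.2 - p.2| < d -> `|u q - u p| < e.

(** Measurability refers to the product sigma-algebra, so the preimage of an open interval is
    written as a countable union of open squares with rational centers and radii. *)
Lemma plane_continuous_measurable (u : R * R -> R) :
  plane_continuous u -> measurable_fun setT u.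
Proof.
move=> cu; apply: (measurability _ (RGenOpens.measurableE R)).
move=> _ [_ [a [b ->] <-]]; rewrite setTI.
pose rect (t : rat * rat * rat) : set (R * R) :=
  ball (ratr t.1.1 : R) (ratr t.2) `*` ball (ratr t.1.2 : R) (ratr t.2).
pose U := u @^-1` `]a, b[.
have -> : u @^-1` `]a, b[ = \bigcup_t (if `[< rect t `<=` U >] then rect t else set0).
  rewrite -/U; apply/seteqP; split=> [p Up|p [t _]]; last first.
    by case: asboolP => // tU tp; exact: tU.
  have [e e0 He] : exists2 e : R, 0 < e & forall y, `|y - u p| < e -> a < y < b.
    move: Up; rewrite /U /= in_itv /= => /andP[ap pb].
    exists (Num.min (u p - a) (b - u p)); first by rewrite lt_min !subr_gt0 ap.
    move=> y; rewrite lt_min !ltr_norml => /andP[/andP[h1 h2] /andP[h3 h4]].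
    by apply/andP; split; lra.
  have [d d0 Hd] := cu p e e0.
  have d20 : 0 < d / 2 by rewrite divr_gt0.
  (* A rational radius below d/2, with rational center coordinates closer than that to those of p,
     puts p in the square and the square in the d-neighborhood of p. *)
  have [r] := rat_in_itvoo d20; rewrite in_itv /= => /andP[r0 rd].
  have lt1 (x : R) : x - ratr r < x + ratr r by lra.
  have [q1] := rat_in_itvoo (lt1 p.1); rewrite in_itv /= => /andP[q1a q1b].
  have [q2] := rat_in_itvoo (lt1 p.2); rewrite in_itv /= => /andP[q2a q2b].
  exists (q1, q2, r) => //.
  have near_p : rect (q1, q2, r) p.
    by split; rewrite /= -ball_normE /ball_ /= ltr_norml; apply/andP; split; lra.
  case: asboolP => // nU; exfalso; apply: nU => q [/= ].
  rewrite -!ball_normE /ball_ /= !ltr_norml => /andP[h1 h2] /andP[h3 h4].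
  rewrite /U /= in_itv /=; apply: He; apply: Hd; rewrite ltr_norml; apply/andP; split; lra.
apply: countable_bigcupT_measurable; first exact: countableP.
move=> t; case: asboolP => // _.
by apply: measurableX; exact: measurable_ball.
Qed.

Lemma plane_continuous_bounded (u : R * R -> R) (M : R) : plane_continuous u ->
  exists B : R, forall p, `|p.1| <= M -> `|p.2| <= M -> `|u p| <= B.
Proof.
move=> cu.
have cont : continuous u.
  move=> p; apply/cvgrPdist_lt => e e0; have [d d0 Hd] := cu p e e0.
  exists (ball p.1 d, ball p.2 d); first by split; exact: nbhsx_ballx.
  move=> q [/= b1 b2]; rewrite distrC; apply: Hd; rewrite distrC.
    by move: b1; rewrite -ball_normE.
  by move: b2; rewrite -ball_normE.
pose K := (`[- M, M] `*` `[- M, M] : set (R * R)).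
have cK : compact K by apply: compact_setX; exact: segment_compact.
have /compact_bounded [B [_ HB]] : compact (u @` K).
  by apply: continuous_compact => //; exact: continuous_subspaceT.
exists (B + 1) => p p1 p2; apply: (HB (B + 1)); first by rewrite ltrDl.
by exists p => //; split; rewrite /= in_itv /= -ler_norml.
Qed.

Lemma abs_le_cmod (z : R[i]) : `|cRe z| <= cmod z /\ `|cIm z| <= cmod z.
Proof.
apply: normr_ReIm_le; first exact: sqrtr_ge0.
by rewrite /cmod sqr_sqrtr // abs2_ge0.
Qed.

Lemma C_CP1_plane_continuous (f : R[i] -> R[i]) : in_C_CP1 f ->
  plane_continuous (fun p => cRe (f (zpt p))) /\ plane_continuous (fun p => cIm (f (zpt p))).
Proof.
move=> [cf _].
have key p (e : R) : 0 < e -> exists2 d : R, 0 < d & forall q, `|q.1 - p.1| < d ->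
    `|q.2 - p.2| < d -> cmod (f (zpt q) - f (zpt p)) < e.
  move=> e0; have [d d0 Hd] := cf (zpt p) e e0.
  exists (d / 2); first by rewrite divr_gt0.
  move=> q q1 q2; apply: Hd; rewrite /cmod -(ger0_norm (ltW d0)) -sqrtr_sqr.
  have sq (x : R) : `|x| < d / 2 -> x ^+ 2 <= (d / 2) ^+ 2.
    move=> xd; rewrite -[x ^+ 2]real_normK ?num_real //.
    by rewrite ler_sqr ?nnegrE // ltW // divr_gt0.
  have s1 := sq _ q1; have s2 := sq _ q2.
  rewrite ltr_sqrt ?exprn_gt0 //.
  have -> : abs2 (zpt q - zpt p) = (q.1 - p.1) ^+ 2 + (q.2 - p.2) ^+ 2 by [].
  have d2 : 0 < d ^+ 2 by rewrite exprn_gt0.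
  rewrite expr_div_n in s1 s2; lra.
split=> p e e0; have [d d0 Hd] := key p e e0; exists d => // q q1 q2;
  apply: le_lt_trans (Hd q q1 q2).
- by rewrite -cReN -cReD; have [] := abs_le_cmod (f (zpt q) - f (zpt p)).
- by rewrite -cImN -cImD; have [] := abs_le_cmod (f (zpt q) - f (zpt p)).
Qed.

Lemma C_CP1_meas (f : R[i] -> R[i]) : in_C_CP1 f -> Cmeas (fun p => f (zpt p)).
Proof.
by move=> /C_CP1_plane_continuous[c1 c2]; split; exact: plane_continuous_measurable.
Qed.

(** Beyond radius [M] the values stay within 1 of the limit at infinity; on the disk of radius [M]
    compactness of the enclosing square applies. *)
Lemma C_CP1_bounded (f : R[i] -> R[i]) : in_C_CP1 f ->
  exists2 B : R, 0 <= B & forall z, abs2 (f z) <= B ^+ 2.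
Proof.
move=> Hf; have [c1 c2] := C_CP1_plane_continuous Hf.
have [_ [L HL]] := Hf; have [M HM] := HL 1 ltr01.
have [B1 H1] := plane_continuous_bounded M c1.
have [B2 H2] := plane_continuous_bounded M c2.
have bnd z : `|cRe (f z)| <= `|B1| + `|cRe L| + 1 /\ `|cIm (f z)| <= `|B2| + `|cIm L| + 1.
  have zE : z = zpt (cRe z, cIm z) by case: z.
  have := normr_ge0 B1; have := normr_ge0 B2.
  have := normr_ge0 (cRe L); have := normr_ge0 (cIm L).
  have := ler_norm B1; have := ler_norm B2.
  case: (leP (cmod z) M) => zM.
    have [z1 z2] := abs_le_cmod z.
    have := H1 (cRe z, cIm z) (le_trans z1 zM) (le_trans z2 zM).
    have := H2 (cRe z, cIm z) (le_trans z1 zM) (le_trans z2 zM).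
    by rewrite -zE => *; split; lra.
  have lt1 := HM z zM; have [d1 d2] := abs_le_cmod (f z - L).
  rewrite cReD cReN in d1; rewrite cImD cImN in d2.
  have t1 := ler_normD (cRe (f z) - cRe L) (cRe L).
  have t2 := ler_normD (cIm (f z) - cIm L) (cIm L).
  by rewrite !subrK in t1 t2 => *; split; lra.
(* The sum of the two bounds works, since x^2 + y^2 <= (x + y)^2 for nonnegative x and y. *)
exists ((`|B1| + `|cRe L| + 1) + (`|B2| + `|cIm L| + 1)); first by rewrite !addr_ge0.
move=> z; have [b1 b2] := bnd z; rewrite /abs2.
have n1 := normr_ge0 (cRe (f z)); have n2 := normr_ge0 (cIm (f z)).
rewrite -[cRe _ ^+ 2]real_normK ?num_real // -[cIm _ ^+ 2]real_normK ?num_real //.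
nra.
Qed.

End PlaneContinuity.

(** * The inner products of H_tau and of the tensor product *)

Section FubiniStudy.
Variable R : realType.
Local Notation leb := (@lebesgue_measure R).
Implicit Types (f g h : R[i] -> R[i]) (c z : R[i]).

Definition adm tau g := Cintegrable (lebC R) (fun p => g (zpt p) * cR (dens tau (zpt p))).

Lemma int_iotaE tau g :
  int_iota tau g = Cintegral (lebC R) (fun p => g (zpt p) * cR (dens tau (zpt p))).
Proof. by []. Qed.

Lemma eq_adm tau g h : g =1 h -> adm tau g -> adm tau h.
Proof. by move=> /funext ->. Qed.

Lemma eq_int_iota tau g h : g =1 h -> int_iota tau g = int_iota tau h.
Proof. by move=> /funext ->. Qed.

Lemma admZ tau c g : adm tau g -> adm tau (fun z => c * g z).
Proof. by move=> ag; rewrite /adm; under eq_fun do rewrite -mulrA; exact: CintegrableZ. Qed.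

Lemma int_iotaZ tau c g : adm tau g ->
  int_iota tau (fun z => c * g z) = c * int_iota tau g.
Proof.
move=> ag; rewrite !int_iotaE -CintegralZ //.
by congr Cintegral; apply/funext => p; rewrite mulrA.
Qed.

Lemma adm_sum tau (I : Type) (r : seq I) (P : pred I) (g : I -> R[i] -> R[i]) :
  (forall i, P i -> adm tau (g i)) -> adm tau (fun z => \sum_(i <- r | P i) g i z).
Proof.
move=> ag; rewrite /adm; under eq_fun do rewrite mulr_suml; exact: Cintegrable_sum.
Qed.

Lemma int_iota_sum tau (I : Type) (r : seq I) (P : pred I) (g : I -> R[i] -> R[i]) :
  (forall i, P i -> adm tau (g i)) ->
  int_iota tau (fun z => \sum_(i <- r | P i) g i z) = \sum_(i <- r | P i) int_iota tau (g i).
Proof.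
move=> ag; rewrite int_iotaE -(Cintegral_sum r ag).
by congr Cintegral; apply/funext => p; rewrite mulr_suml.
Qed.

Lemma densE tau z : dens tau z = tau.+1%:R / pi * (1 + abs2 z) ^- (tau + 2).
Proof. by rewrite /dens invfM mulrA. Qed.

(** Bounded measurable symbols, for which every integral of f p q^- with p and q in H_tau converges.
    The symbol 1 gives the inner product itself. *)
Definition bmeas f := Cmeas (fun p => f (zpt p)) /\
  exists2 B : R, 0 <= B & forall z, abs2 (f z) <= B ^+ 2.

Lemma bmeas1 : bmeas (fun _ => 1).
Proof.
split; first exact: Cmeas_cst.
by exists 1 => // z; rewrite -(rmorph1 (@cR R)) abs2_cR.
Qed.

(** The density decays like (1 + |z|^2)^-(tau + 2), so the growth allowed to [g] leaves an
    integrable (1 + |z|^2)^-2. *)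
Lemma adm_bmeasM tau f g (K : R) : bmeas f -> Cmeas (fun p => g (zpt p)) -> 0 <= K ->
  (forall z, abs2 (g z) <= (K * (1 + abs2 z) ^+ tau) ^+ 2) -> adm tau (fun z => f z * g z).
Proof.
move=> [mf [B B0 fB]] mg K0 gK.
pose b p := (B * K * (tau.+1%:R / pi)) * (1 + abs2 (zpt p)) ^- 2.
have ib : (lebC R).-integrable setT (EFin \o b).
  rewrite /b (_ : _ \o _ = (fun p => (B * K * (tau.+1%:R / pi))%:E *
    ((1 + abs2 (zpt p)) ^- 2)%:E)%E) //.
  by apply: integrableZl => //; exact: integrable_base.
have c0 : 0 <= tau.+1%:R / pi :> R by rewrite divr_ge0 ?ler0n ?pi_ge0.
apply: le_Cintegrable ib.
- apply: CmeasM; first exact: CmeasM.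
  apply: Cmeas_cR; under eq_fun do rewrite densE.
  apply: measurable_funM; first exact: measurable_cst.
  by apply: measurable_oneDabs2V; exact: Cmeas_zpt.
- move=> p; rewrite /b; apply: mulr_ge0; last by rewrite invr_ge0 sqr_ge0.
  by apply: mulr_ge0 => //; exact: mulr_ge0.
- move=> p; rewrite !abs2M abs2_cR densE /b.
  have p0 := oneDabs2_gt0 (zpt p).
  set u := 1 + abs2 (zpt p) in p0 *.
  have un0 : u != 0 by rewrite gt_eqF.
  have -> : (B * K * (tau.+1%:R / pi) / u ^+ 2) ^+ 2 =
            B ^+ 2 * (K * u ^+ tau) ^+ 2 * (tau.+1%:R / pi / u ^+ (tau + 2)) ^+ 2.
    have ut : u ^+ tau != 0 by rewrite expf_neq0.
    rewrite exprD; move: (_ / pi) (u ^+ tau) ut => w v v0.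
    by field; rewrite un0 v0.
  apply: ler_wpM2r; first exact: sqr_ge0.
  by apply: ler_pM; rewrite ?abs2_ge0 //; exact: gK.
Qed.

Lemma adm_mon tau f a b : bmeas f -> (a <= tau)%N -> (b <= tau)%N ->
  adm tau (fun z => f z * (z ^+ a * cconj z ^+ b)).
Proof.
move=> bf al bl; apply: (@adm_bmeasM _ _ _ 1) => //.
- apply: CmeasM; apply: CmeasX; first exact: Cmeas_zpt.
  exact/Cmeas_conj/Cmeas_zpt.
- move=> z; rewrite abs2M !abs2X abs2_conj -exprD mul1r -exprM.
  have z0 := abs2_ge0 z.
  apply: (@le_trans _ _ ((1 + abs2 z) ^+ (a + b))).
    by apply: lerXn2r; rewrite ?nnegrE ?z0 ?(ltW (oneDabs2_gt0 z)) // lerDr.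
  by apply: ler_weXn2l; rewrite ?oneDabs2_ge1 //; lia.
Qed.

(** For a = b the value is (tau + 1)/pi times pi a! (tau - a)! / (tau + 1)!, the reciprocal of
    binom(tau, a). *)
Lemma int_iota_mon tau a b : (a <= tau)%N -> (b <= tau)%N ->
  int_iota tau (fun z => z ^+ a * cconj z ^+ b) = (a == b)%:R / 'C(tau, a)%:R.
Proof.
move=> al bl.
transitivity (cR (tau.+1%:R / pi) * moment R a b (tau + 2)).
  rewrite int_iotaE /moment -CintegralZ; last by apply: Cintegrable_zmon; lia.
  congr Cintegral; apply/funext => p.
  by rewrite /zmon densE rmorphM /= mulrCA.
have [<-{b bl}|ab] := eqVneq a b; last by rewrite moment_neq ?mulr0 ?mul0r //; lia.
have -> : (tau + 2 = (a + (tau - a)).+2)%N by lia.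
rewrite momentE subnKC // -rmorphM /= mul1r -(rmorph_nat (@cR R)) -fmorphV; congr cR.
have e1 : tau`!%:R = 'C(tau, a)%:R * (a`! * (tau - a)`!)%:R :> R.
  by rewrite -natrM bin_fact.
have e2 : tau.+1`!%:R = tau.+1%:R * tau`!%:R :> R by rewrite factS natrM.
have n1 : (a`! * (tau - a)`!)%:R != 0 :> R by rewrite pnatr_eq0 -lt0n muln_gt0 !fact_gt0.
have n2 : 'C(tau, a)%:R != 0 :> R by rewrite pnatr_eq0 -lt0n bin_gt0.
have n3 : tau.+1%:R != 0 :> R by rewrite pnatr_eq0.
have n4 : pi != 0 :> R by rewrite gt_eqF // pi_gt0.
rewrite e2 e1; move: (@pi R) (_%:R) (tau.+1%:R) (_%:R) n1 n2 n3 n4 => x A B C n1 n2 n3 n4.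
by field; rewrite n1 n2 n3 n4.
Qed.

Lemma horner_conjE tau (p q : {poly R[i]}) z : (size p <= tau.+1)%N -> (size q <= tau.+1)%N ->
  p.[z] * cconj q.[z] =
  \sum_(i < tau.+1) \sum_(j < tau.+1) p`_i * cconj q`_j * (z ^+ i * cconj z ^+ j).
Proof.
move=> sp sq; rewrite (horner_coef_wide _ sp) (horner_coef_wide _ sq) rmorph_sum /=.
rewrite mulr_suml; apply: eq_bigr => i _; rewrite mulr_sumr; apply: eq_bigr => j _.
by rewrite rmorphM rmorphXn /=; ring.
Qed.

Lemma adm_poly tau f (p q : {poly R[i]}) : bmeas f -> (size p <= tau.+1)%N -> (size q <= tau.+1)%N ->
  adm tau (fun z => f z * (p.[z] * cconj q.[z])).
Proof.
move=> bf sp sq.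
apply: (@eq_adm _ (fun z => \sum_(i < tau.+1) \sum_(j < tau.+1)
   p`_i * cconj q`_j * (f z * (z ^+ i * cconj z ^+ j)))).
  move=> z; rewrite (horner_conjE _ sp sq) mulr_sumr; apply: eq_bigr => i _.
  by rewrite mulr_sumr; apply: eq_bigr => j _; rewrite mulrCA.
apply: adm_sum => i _; apply: adm_sum => j _; apply: admZ.
by apply: adm_mon => //; rewrite -ltnS.
Qed.

Lemma int_iota_poly tau f (p q : {poly R[i]}) : bmeas f -> (size p <= tau.+1)%N -> (size q <= tau.+1)%N ->
  int_iota tau (fun z => f z * (p.[z] * cconj q.[z])) =
  \sum_(i < tau.+1) \sum_(j < tau.+1)
     p`_i * cconj q`_j * int_iota tau (fun z => f z * (z ^+ i * cconj z ^+ j)).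
Proof.
move=> bf sp sq.
have am (i j : 'I_tau.+1) : adm tau (fun z => f z * (z ^+ i * cconj z ^+ j)).
  by apply: adm_mon => //; rewrite -ltnS.
transitivity (int_iota tau (fun z => \sum_(i < tau.+1) \sum_(j < tau.+1)
   p`_i * cconj q`_j * (f z * (z ^+ i * cconj z ^+ j)))).
  apply: eq_int_iota => z; rewrite (horner_conjE _ sp sq) mulr_sumr; apply: eq_bigr => i _.
  by rewrite mulr_sumr; apply: eq_bigr => j _; rewrite mulrCA.
rewrite int_iota_sum; last by move=> i _; apply: adm_sum => j _; exact: admZ.
apply: eq_bigr => i _; rewrite int_iota_sum; last by move=> j _; exact: admZ.
by apply: eq_bigr => j _; rewrite int_iotaZ.
Qed.

(** The inner product of H_tau in monomial coordinates, the Hermitian version of the apolar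
    pairing. *)
Definition hform tau (p q : {poly R[i]}) : R[i] := \sum_(i < tau.+1) p`_i * cconj q`_i / 'C(tau, i)%:R.

Lemma int_iota_hform tau (p q : {poly R[i]}) : (size p <= tau.+1)%N -> (size q <= tau.+1)%N ->
  adm tau (fun z => p.[z] * cconj q.[z]) /\
  int_iota tau (fun z => p.[z] * cconj q.[z]) = hform tau p q.
Proof.
move=> sp sq.
have e : (fun z => p.[z] * cconj q.[z]) =1 (fun z => 1 * (p.[z] * cconj q.[z])).
  by move=> z; rewrite mul1r.
split; first by apply: eq_adm (fsym e) _; exact: adm_poly bmeas1 sp sq.
rewrite (eq_int_iota _ e) (int_iota_poly bmeas1 sp sq).
apply: eq_bigr => i _; rewrite (bigD1 i) //= big1.
  rewrite addr0; congr (_ * _).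
  rewrite (@eq_int_iota _ _ (fun z => z ^+ i * cconj z ^+ i)); last by move=> z; rewrite mul1r.
  by rewrite int_iota_mon ?eqxx ?mul1r // -ltnS.
move=> j ji; rewrite (@eq_int_iota _ _ (fun z => z ^+ i * cconj z ^+ j)); last first.
  by move=> z; rewrite mul1r.
rewrite int_iota_mon -1?ltnS //.
by rewrite eq_sym (negbTE (_ : (j : nat) != i)) ?mul0r ?mulr0 // val_eqE.
Qed.

Definition adm2 mu nu (G : R[i] -> R[i] -> R[i]) := Cintegrable (lebC2 R)
  (fun p => G (zpt p.1.1) (zpt (p.1.2, p.2)) * cR (dens mu (zpt p.1.1)) *
            cR (dens nu (zpt (p.1.2, p.2)))).

Lemma int_iota2E mu nu (G : R[i] -> R[i] -> R[i]) :
  int_iota2 mu nu G = Cintegral (lebC2 R)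
  (fun p => G (zpt p.1.1) (zpt (p.1.2, p.2)) * cR (dens mu (zpt p.1.1)) *
            cR (dens nu (zpt (p.1.2, p.2)))).
Proof. by []. Qed.

Lemma int_iota2_tens mu nu g h : adm mu g -> adm nu h ->
  adm2 mu nu (fun z w => g z * h w) /\
  int_iota2 mu nu (fun z w => g z * h w) = int_iota mu g * int_iota nu h.
Proof.
move=> ag ah.
(* The plane of z is a single factor while the two coordinates of w stay separate, matching the
   bracketing of [lebC2]. *)
have [i e] := @Cintegral_tens R _ _ _ _ _ _ (sigma_finite_prod leb leb) leb leb _ _ ag ah.
have E : (fun p : R * R * R * R => g (zpt p.1.1) * h (zpt (p.1.2, p.2)) *
   cR (dens mu (zpt p.1.1)) * cR (dens nu (zpt (p.1.2, p.2)))) =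
   (fun p => (g (zpt p.1.1) * cR (dens mu (zpt p.1.1))) *
    (h (zpt (p.1.2, p.2)) * cR (dens nu (zpt (p.1.2, p.2))))).
  by apply/funext => p; rewrite mulrACA mulrA.
by split; rewrite ?int_iota2E /adm2 E //; exact: i.
Qed.

Lemma int_iota2_sum mu nu (I : Type) (r : seq I) (P : pred I) (G : I -> R[i] -> R[i] -> R[i]) :
  (forall i, P i -> adm2 mu nu (G i)) ->
  adm2 mu nu (fun z w => \sum_(i <- r | P i) G i z w) /\
  int_iota2 mu nu (fun z w => \sum_(i <- r | P i) G i z w) =
  \sum_(i <- r | P i) int_iota2 mu nu (G i).
Proof.
move=> ag; split.
  by rewrite /adm2; under eq_fun do rewrite !mulr_suml; exact: Cintegrable_sum.
rewrite int_iota2E -(Cintegral_sum r ag).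
by congr Cintegral; apply/funext => p; rewrite !mulr_suml.
Qed.

(** Finite sums of elementary tensors. They represent all elements of the tensor product and make
    the double integrals factor. *)
Definition tsum (I : finType) (A B : I -> {poly R[i]}) (z w : R[i]) : R[i] :=
  \sum_i (A i).[z] * (B i).[w].

Lemma ip2_tsum mu nu (I J : finType) (A B : I -> {poly R[i]}) (P Q : J -> {poly R[i]}) :
  (forall i, size (A i) <= mu.+1)%N -> (forall i, size (B i) <= nu.+1)%N ->
  (forall j, size (P j) <= mu.+1)%N -> (forall j, size (Q j) <= nu.+1)%N ->
  ip2 mu nu (tsum A B) (tsum P Q) =
  \sum_i \sum_j hform mu (A i) (P j) * hform nu (B i) (Q j).
Proof.
move=> sA sB sP sQ.
have tE i j := int_iota2_tens (int_iota_hform (sA i) (sP j)).1 (int_iota_hform (sB i) (sQ j)).1.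
transitivity (int_iota2 mu nu (fun z w => \sum_i \sum_j
   ((A i).[z] * cconj (P j).[z]) * ((B i).[w] * cconj (Q j).[w]))).
  rewrite /ip2; congr int_iota2; apply/funext => z; apply/funext => w.
  rewrite /tsum rmorph_sum mulr_suml; apply: eq_bigr => i _.
  rewrite mulr_sumr; apply: eq_bigr => j _.
  by rewrite rmorphM /= mulrACA.
rewrite (int_iota2_sum _ _).2; last first.
  by move=> i _; apply: (int_iota2_sum _ _).1 => j _; exact: (tE i j).1.
apply: eq_bigr => i _; rewrite (int_iota2_sum _ _).2; last by move=> j _; exact: (tE i j).1.
apply: eq_bigr => j _.
by rewrite (tE i j).2 (int_iota_hform (sA i) (sP j)).2 (int_iota_hform (sB i) (sQ j)).2.
Qed.

End FubiniStudy.

(** * Coefficient form of the inner product and the reproducing kernel *)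

Section Form.
Variable R : realType.
Implicit Types (p q : {poly R[i]}) (c xi : R[i]).

Lemma hformZl tau c p q : hform tau (c *: p) q = c * hform tau p q.
Proof. by rewrite mulr_sumr; apply: eq_bigr => i _; rewrite coefZ !mulrA. Qed.

Lemma hformZr tau c p q : hform tau p (c *: q) = cconj c * hform tau p q.
Proof. by rewrite mulr_sumr; apply: eq_bigr => i _; rewrite coefZ rmorphM /=; ring. Qed.

Lemma hform_suml tau (I : finType) (p : I -> {poly R[i]}) q :
  hform tau (\sum_i p i) q = \sum_i hform tau (p i) q.
Proof.
rewrite /hform exchange_big; apply: eq_bigr => i _.
by rewrite coef_sum !mulr_suml.
Qed.

Lemma hform_sumr tau (I : finType) p (q : I -> {poly R[i]}) :
  hform tau p (\sum_i q i) = \sum_i hform tau p (q i).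
Proof.
rewrite /hform exchange_big; apply: eq_bigr => i _.
by rewrite coef_sum rmorph_sum mulr_sumr mulr_suml.
Qed.

Lemma hform_Xn tau a q : (a <= tau)%N -> hform tau 'X^a q = cconj q`_a / 'C(tau, a)%:R.
Proof.
move=> at_; rewrite /hform (bigD1 (Ordinal (at_ : a < tau.+1)%N)) //= big1.
  by rewrite addr0 coefXn eqxx mul1r.
move=> i ni; rewrite coefXn; rewrite -val_eqE /= in ni.
by rewrite (negbTE ni) !mul0r.
Qed.

Lemma coef_oneDX c m i : ((1 + c *: 'X : {poly R[i]}) ^+ m)`_i = c ^+ i *+ 'C(m, i).
Proof. by rewrite -polyC1 coef_linX expr1n mul1r. Qed.

(** The reproducing property: the binomial coefficients of the kernel cancel the weights of the
    form. *)
Lemma hform_Kern tau p y : (size p <= tau.+1)%N ->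
  hform tau p ((1 + cconj y *: 'X) ^+ tau) = p.[y].
Proof.
move=> sp; rewrite (horner_coef_wide _ sp); apply: eq_bigr => i _.
have ib : 'C(tau, i)%:R != 0 :> R[i] by rewrite pnatr_eq0 -lt0n bin_gt0 -ltnS.
by rewrite coef_oneDX rmorphMn rmorphXn /= cconjK -[_ *+ 'C(_, _)]mulr_natr mulrA mulfK.
Qed.

Lemma size_XnM_oneDX a m c : (size ('X^a * (1 + c *: 'X) ^+ m : {poly R[i]})%R <= (a + m).+1)%N.
Proof.
have := @size_apolar R[i] (a + m) a 0 c (leq_addr _ _).
by rewrite /apolar subr0 addKn.
Qed.

(* The conjugate of a coefficient of [(1 + conj xi X)^m] is a polynomial in [xi]. *)
Lemma hform_poly tau p a m : exists2 r : {poly R[i]}, (size r <= m.+1)%N &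
  forall xi, hform tau p ('X^a * (1 + cconj xi *: 'X) ^+ m) = r.[xi].
Proof.
exists (\sum_(i < tau.+1) (if (i < a)%N then 0 else
   (p`_i / 'C(tau, i)%:R * 'C(m, i - a)%:R) *: 'X^(i - a))).
  apply: (leq_trans (size_sum _ _ _)); apply/bigmax_leqP => i _.
  case: ifP => _; first by rewrite size_poly0.
  have [mi|im] := ltnP m (i - a); first by rewrite (bin_small mi) mulr0 scale0r size_poly0.
  by rewrite (leq_trans (size_scale_leq _ _)) // size_polyXn.
move=> xi; rewrite horner_sum; apply: eq_bigr => i _; rewrite coefXnM.
case: ifP => _; first by rewrite rmorph0 mulr0 mul0r horner0.
rewrite coef_oneDX rmorphMn rmorphXn /= cconjK hornerZ hornerXn.
by rewrite -[_ *+ 'C(_, _)]mulr_natr; ring.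
Qed.

End Form.

(** * The operator P_k, its adjoint, and Toeplitz operators on tensors *)

Section Intertwiner.
Variable R : realType.
Implicit Types (p q : {poly R[i]}) (c xi y z w s : R[i]) (f : R[i] -> R[i]).

Lemma inH2_tsum mu nu (F : R[i] -> R[i] -> R[i]) : inH2 mu nu F ->
  exists2 B : 'I_mu.+1 -> {poly R[i]}, (forall i, size (B i) <= nu.+1)%N &
    F = tsum (fun i : 'I_mu.+1 => 'X^i) B.
Proof.
move=> [c Fc]; exists (fun i => \poly_(j < nu.+1) c i (inord j)).
  by move=> i; exact: size_poly.
apply/funext => z; apply/funext => w; rewrite Fc /tsum; apply: eq_bigr => i _.
rewrite horner_poly mulr_sumr; apply: eq_bigr => j _.
by rewrite inord_val hornerXn; ring.
Qed.

Lemma tsum_inH2 mu nu (I : finType) (A B : I -> {poly R[i]}) :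
  (forall i, size (A i) <= mu.+1)%N -> (forall i, size (B i) <= nu.+1)%N ->
  inH2 mu nu (tsum A B).
Proof.
move=> sA sB; exists (\matrix_(i, j) \sum_t (A t)`_i * (B t)`_j) => z w.
rewrite /tsum; under eq_bigr => t _.
  rewrite (horner_coef_wide _ (sA t)) (horner_coef_wide _ (sB t)) mulr_suml.
  over.
rewrite exchange_big; apply: eq_bigr => i _ /=.
under eq_bigr => t _ do rewrite mulr_sumr.
rewrite exchange_big; apply: eq_bigr => j _ /=.
by rewrite mxE !mulr_suml; apply: eq_bigr => t _; ring.
Qed.

(** Nondegeneracy: testing against the monomials z^i w^j recovers every coefficient. *)
Lemma ip2_inj mu nu (D D' : R[i] -> R[i] -> R[i]) : inH2 mu nu D -> inH2 mu nu D' ->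
  (forall F, inH2 mu nu F -> ip2 mu nu F D = ip2 mu nu F D') -> D = D'.
Proof.
move=> /inH2_tsum[B sB ->] /inH2_tsum[B' sB' ->] H.
have sX (i : 'I_mu.+1) : (size ('X^i : {poly R[i]}) <= mu.+1)%N by rewrite size_polyXn.
suff E i : B i = B' i by congr tsum; apply/funext.
apply/polyP => j; have [jn|jn] := ltnP j nu.+1; last first.
  by rewrite !nth_default // (leq_trans _ jn).
have sY (u : 'I_1) : (size ('X^j : {poly R[i]}) <= nu.+1)%N by rewrite size_polyXn.
have := H (tsum (fun _ : 'I_1 => 'X^i) (fun _ : 'I_1 => 'X^j))
  (tsum_inH2 (fun _ => sX i) sY).
rewrite !(ip2_tsum (fun _ => sX i) sY sX) // !big_ord1.
have key (C : 'I_mu.+1 -> {poly R[i]}) :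
    \sum_(t < mu.+1) hform mu 'X^i 'X^t * hform nu 'X^j (C t) =
    ('C(mu, i)%:R)^-1 * (cconj (C i)`_j / 'C(nu, j)%:R).
  rewrite (bigD1 i) //= big1 ?addr0.
    by rewrite !hform_Xn -1?ltnS // coefXn eqxx rmorph1 mul1r.
  move=> t ti; rewrite hform_Xn -1?ltnS // coefXn (_ : (_ == _) = false).
    by rewrite rmorph0 !mul0r.
  by apply/negbTE; rewrite eq_sym -val_eqE in ti *.
rewrite !key => E.
have n1 : ('C(mu, i)%:R)^-1 != 0 :> R[i].
  by rewrite invr_eq0 pnatr_eq0 -lt0n bin_gt0 -ltnS.
have n2 : ('C(nu, j)%:R)^-1 != 0 :> R[i].
  by rewrite invr_eq0 pnatr_eq0 -lt0n bin_gt0 -ltnS.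
by have /(mulfI n1)/(mulIf n2)/(congr1 (@cconj R)) := E; rewrite !cconjK.
Qed.

Section Kernel.
Variables (mu nu k : nat).
Hypotheses (kmu : (k <= mu)%N) (munu : (mu < nu)%N).
Let knu : (k <= nu)%N. Proof. by lia. Qed.
Let N := (mu + nu - 2 * k)%N.

(** [gP] and [gQ] come from the binomial expansion of (z - w)^k; their tensor sum is G_xi. *)
Definition gP xi (t : 'I_k.+1) : {poly R[i]} :=
  'X^(k - t) * (1 + cconj xi *: 'X) ^+ (mu - k).
Definition gQ xi (t : 'I_k.+1) : {poly R[i]} :=
  ((-1) ^+ t * 'C(k, t)%:R) *: ('X^t * (1 + cconj xi *: 'X) ^+ (nu - k)).

Lemma size_gP xi t : (size (gP xi t) <= mu.+1)%N.
Proof. by apply: (leq_trans (size_XnM_oneDX _ _ _)); lia. Qed.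

Lemma size_gQ xi t : (size (gQ xi t) <= nu.+1)%N.
Proof.
apply: (leq_trans (size_scale_leq _ _)); apply: (leq_trans (size_XnM_oneDX _ _ _)).
by case: t => t /= ht; lia.
Qed.

Lemma tsum_gPQ xi z w : tsum (gP xi) (gQ xi) z w =
  (z - w) ^+ k * (1 + z * cconj xi) ^+ (mu - k) * (1 + w * cconj xi) ^+ (nu - k).
Proof.
rewrite exprDn !mulr_suml; apply: eq_bigr => t _.
rewrite /gP /gQ !(hornerM, hornerZ, hornerXn, horner_exp, hornerD, hornerX, hornerC).
by rewrite [(- w) ^+ t]exprNn -[_ *+ 'C(_, _)]mulr_natr !(mulrC (cconj xi)); ring.
Qed.

(** The integrand of J_k is F times the conjugate of G_xi. *)
Lemma Jk_ip2 F xi : Jk mu nu k F xi = ip2 mu nu F (tsum (gP xi) (gQ xi)).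
Proof.
rewrite /Jk /ip2; congr int_iota2; apply/funext => z; apply/funext => w.
rewrite tsum_gPQ !(rmorphM, rmorphXn, rmorphD, rmorph1) /= cconjK rmorphN /=.
by rewrite !(mulrC xi); ring.
Qed.

(** Puts P_k F in H_N, so that the reproducing property applies to it. The degrees mu - k and nu - k
    in xi of the two factors add up to N. *)
Lemma Pk_poly F : inH2 mu nu F ->
  exists2 r : {poly R[i]}, (size r <= N.+1)%N & forall xi, Pk mu nu k F xi = r.[xi].
Proof.
move=> /inH2_tsum[B sB ->].
have sX (i : 'I_mu.+1) : (size ('X^i : {poly R[i]}) <= mu.+1)%N by rewrite size_polyXn.
have h1 (it : 'I_mu.+1 * 'I_k.+1) : exists r : {poly R[i]},
    (size r <= (mu - k).+1)%N /\ forall xi, hform mu 'X^(it.1) (gP xi it.2) = r.[xi].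
  by have [r sr Hr] := @hform_poly R mu 'X^(it.1) (k - it.2) (mu - k); exists r.
have [r1 Hr1] := boolp.choice h1.
have h2 (it : 'I_mu.+1 * 'I_k.+1) : exists r : {poly R[i]},
    (size r <= (nu - k).+1)%N /\ forall xi, hform nu (B it.1) (gQ xi it.2) = r.[xi].
  have [r sr Hr] := @hform_poly R nu (B it.1) it.2 (nu - k).
  exists (cconj ((-1) ^+ it.2 * 'C(k, it.2)%:R) *: r); split.
    by rewrite (leq_trans (size_scale_leq _ _)).
  by move=> xi; rewrite /gQ hformZr Hr hornerZ.
have [r2 Hr2] := boolp.choice h2.
exists (cR (Cmnk mu nu k) *: \sum_i \sum_t (r1 (i, t) * r2 (i, t))).
  apply: (leq_trans (size_scale_leq _ _)).
  apply: (leq_trans (size_sum _ _ _)); apply/bigmax_leqP => i _.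
  apply: (leq_trans (size_sum _ _ _)); apply/bigmax_leqP => t _.
  apply: (leq_trans (size_polyMleq _ _)).
  have [+ _] := Hr1 (i, t); have [+ _] := Hr2 (i, t).
  move: (size (r1 _)) (size (r2 _)) => a b; rewrite /N; lia.
move=> xi; rewrite /Pk Jk_ip2 (ip2_tsum sX sB (size_gP xi) (size_gQ xi)).
rewrite hornerZ horner_sum; congr (_ * _); apply: eq_bigr => i _.
rewrite horner_sum; apply: eq_bigr => t _; rewrite hornerM.
by have [_ <-] := Hr1 (i, t); have [_ <-] := Hr2 (i, t).
Qed.

(** For every F, <F, Q K_y> = <P_k F, K_y> = (P_k F)(y) = C <F, G_y>, and nondegeneracy identifies
    the second argument. The constant C is real, so it crosses the pairing unchanged. *)
Lemma adjoint_Kern Q y : is_adjoint_Pk mu nu k Q ->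
  Q (fun x => Kern N x y) =
  tsum (gP y) (fun t => cR (Cmnk mu nu k) *: gQ y t).
Proof.
move=> adj.
have KE : (fun x => Kern N x y) = (fun x => ((1 + cconj y *: 'X) ^+ N).[x]).
  apply/funext => x; rewrite horner_exp !(hornerD, hornerZ, hornerX, hornerC).
  by rewrite /Kern mulrC.
have sK : (size ((1 + cconj y *: 'X) ^+ N : {poly R[i]})%R <= N.+1)%N.
  by have := @size_XnM_oneDX R 0 N (cconj y); rewrite mul1r add0n.
have inK : inH N (fun x => Kern N x y).
  by exists ((1 + cconj y *: 'X) ^+ N); split => // z; rewrite -[LHS]/((fun x => _) z) KE.
have [inQ adjQ] := adj _ inK.
have sCQ t : (size (cR (Cmnk mu nu k) *: gQ y t) <= nu.+1)%N.
  by rewrite (leq_trans (size_scale_leq _ _)) // size_gQ.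
apply: (@ip2_inj mu nu) => //; first exact: tsum_inH2 (size_gP y) sCQ.
move=> F inF; rewrite -adjQ //.
have [r sr Hr] := Pk_poly inF.
transitivity (Pk mu nu k F y).
  rewrite KE /ip Hr -(hform_Kern _ sr) -(int_iota_hform sr sK).2.
  by apply: eq_int_iota => z; rewrite Hr.
rewrite /Pk Jk_ip2; have [B sB ->] := inH2_tsum inF.
have sX (i : 'I_mu.+1) : (size ('X^i : {poly R[i]}) <= mu.+1)%N by rewrite size_polyXn.
rewrite (ip2_tsum sX sB (size_gP y) (size_gQ y)) (ip2_tsum sX sB (size_gP y) sCQ).
rewrite mulr_sumr; apply: eq_bigr => i _; rewrite mulr_sumr; apply: eq_bigr => t _.
by rewrite hformZr cconj_cR mulrCA.
Qed.

(** The factors depending on w leave the integral, so the operator acts on the [A i] alone. The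
    identity for [hform] is the weak form of the Toeplitz operator, through which its image is used
    later. *)
Lemma tensI_tsum f (I : finType) (A B : I -> {poly R[i]}) : bmeas f ->
  (forall i, size (A i) <= mu.+1)%N ->
  exists2 A' : I -> {poly R[i]},
    (forall i, size (A' i) <= mu.+1)%N /\
    (forall i q, (size q <= mu.+1)%N -> hform mu (A' i) q =
       cR mu.+1%:R^-1 * int_iota mu (fun s => f s * ((A i).[s] * cconj q.[s]))) &
    tensI (Rstar mu f) (tsum A B) = tsum A' B.
Proof.
move=> bf sA.
pose J i (j : nat) := int_iota mu (fun s => f s * ((A i).[s] * cconj ('X^j).[s])).
have sX (i : 'I_mu.+1) : (size ('X^i : {poly R[i]}) <= mu.+1)%N by rewrite size_polyXn.
(* Coefficients read off from the expansion of (1 + z s^-)^mu in powers of z s^-. *)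
pose A' i := \poly_(j < mu.+1) (cR mu.+1%:R^-1 * 'C(mu, j)%:R * J i j).
have aJ i (j : 'I_mu.+1) := adm_poly bf (sA i) (sX j).
exists A'; first split=> [i|i q sq].
- exact: size_poly.
- have -> : int_iota mu (fun s => f s * ((A i).[s] * cconj q.[s])) =
      \sum_(j < mu.+1) cconj q`_j * J i j.
    rewrite /J; under [RHS]eq_bigr => j _ do rewrite -(int_iotaZ _ (aJ i j)).
    rewrite -int_iota_sum; last by move=> j _; exact: admZ.
    apply: eq_int_iota => s; rewrite (horner_coef_wide _ sq) rmorph_sum !mulr_sumr.
    by apply: eq_bigr => j _; rewrite rmorphM /= hornerXn; ring.
  rewrite mulr_sumr; apply: eq_bigr => j _; rewrite coef_poly ltn_ord.
  have ib : 'C(mu, j)%:R != 0 :> R[i] by rewrite pnatr_eq0 -lt0n bin_gt0 -ltnS.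
  by rewrite -[RHS](mulfK ib); congr (_ / _); ring.
apply/funext => z; apply/funext => w; rewrite /tensI /Rstar.
rewrite (@eq_int_iota _ _ _ (fun s => \sum_i \sum_(j < mu.+1)
   ((B i).[w] * 'C(mu, j)%:R * z ^+ j) * (f s * ((A i).[s] * cconj ('X^j).[s])))).
  rewrite int_iota_sum; last first.
    by move=> i _; apply: adm_sum => j _; exact: admZ.
  rewrite mulr_sumr; apply: eq_bigr => i _.
  rewrite int_iota_sum; last by move=> j _; exact: admZ.
  rewrite horner_poly mulr_sumr mulr_suml; apply: eq_bigr => j _.
  by rewrite (int_iotaZ _ (aJ i j)) -/(J i j); ring.
move=> s; rewrite /tsum mulr_sumr mulr_suml; apply: eq_bigr => i _.
rewrite exprDn mulr_sumr; apply: eq_bigr => j _.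
by rewrite expr1n mul1r hornerXn exprMn rmorphXn /= -[_ *+ 'C(_, _)]mulr_natr; ring.
Qed.

(** The slice of G_y at z = s, as a polynomial in w; (-1)^k comes from replacing s - w by w - s. *)
Lemma sum_gPQ y s :
  \sum_t (gP y t).[s] *: gQ y t =
  ((-1) ^+ k * (1 + s * cconj y) ^+ (mu - k)) *: apolar nu k s (cconj y).
Proof.
have -> : apolar nu k s (cconj y) =
   (-1) ^+ k *: ((s%:P - 'X) ^+ k * (1 + cconj y *: 'X) ^+ (nu - k)).
  have -> : apolar nu k s (cconj y) =
      (- (s%:P - 'X)) ^+ k * (1 + cconj y *: 'X) ^+ (nu - k) by rewrite opprB.
  rewrite (exprNn (s%:P - 'X)) -mulrA -(mul_polyC ((-1) ^+ k)).
  by rewrite polyC_exp polyCN polyC1.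
rewrite scalerA mulrAC -exprMn mulrNN mulr1 expr1n mul1r.
rewrite (exprDn s%:P (- 'X)) mulr_suml scaler_sumr; apply: eq_bigr => t _.
rewrite /gP /gQ !(hornerM, hornerZ, hornerXn, horner_exp, hornerD, hornerX, hornerC).
rewrite [(- 'X) ^+ t]exprNn -polyC_exp -!mul_polyC.
rewrite !(polyCM, polyC_exp, polyCD, polyC1, polyCN, polyC_natr).
by rewrite (mulrC s%:P (cconj y)%:P); ring.
Qed.

Lemma conj_apolar n j s c i :
  cconj (apolar n j s c)`_i = (apolar n j (cconj s) (cconj c))`_i.
Proof.
rewrite -coef_map /apolar rmorphM !rmorphXn /= rmorphB rmorphD rmorph1 /=.
by rewrite map_polyZ map_polyX map_polyC.
Qed.

End Kernel.
End Intertwiner.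

(** * The expansion *)

Section Expansion.
Variables (R : realType) (mu nu k : nat).
Hypotheses (kmu : (k <= mu)%N) (munu : (mu < nu)%N).
Implicit Types (y s : R[i]) (f : R[i] -> R[i]).
Let knu : (k <= nu)%N. Proof. by lia. Qed.

Definition bcoef l : R := (-1) ^+ (k - l) * ('C(nu - k, k - l))%:R *
  (((nu - k + l)`! * k`!)%:R / ((nu`! * l`!)%:R)).

(** Up to normalization, the density relative to diota_mu of the kernel of the Berezin transform of
    level mu - l. *)
Definition bker l y s : R := abs2 (1 + y * cconj s) ^+ (mu - l) * (1 + abs2 s) ^+ l.

(** By sesquilinearity the left side is the squared norm in H_nu of the slice of G_y at z = s, that
    is, |1 + s y^-|^(2 (mu - k)) W(s, y); [apolar_normE] evaluates it. *)
Lemma sum_gPQ_hform y s :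
  \sum_(t < k.+1) \sum_(u < k.+1) ((gP mu y t).[s] * cconj (gP mu y u).[s]) *
     hform nu (gQ nu (k := k) y t) (gQ nu y u) =
  \sum_(l < k.+1) cR (bcoef l * (1 + abs2 y) ^+ (nu - k - (k - l))) * cR (bker l y s).
Proof.
transitivity (hform nu (\sum_(t < k.+1) (gP mu y t).[s] *: gQ nu (k := k) y t)
                       (\sum_(u < k.+1) (gP mu y u).[s] *: gQ nu (k := k) y u)).
  rewrite hform_suml; apply: eq_bigr => t _; rewrite hform_sumr; apply: eq_bigr => u _.
  by rewrite [RHS]hformZl [X in _ = _ * X]hformZr mulrA.
rewrite sum_gPQ hformZl hformZr.
have -> : hform nu (apolar nu k s (cconj y)) (apolar nu k s (cconj y)) =
   \sum_(i < nu.+1) (apolar nu k s (cconj y))`_i * (apolar nu k (cconj s) y)`_i / 'C(nu, i)%:R.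
  by apply: eq_bigr => i _; rewrite conj_apolar cconjK.
rewrite (apolar_normE _ _ _ _ knu) !mulr_sumr; apply: eq_bigr => l _.
have lk : (l <= k)%N by rewrite -ltnS.
have cX : cR (abs2 (1 + y * cconj s)) = (1 + s * cconj y) * (1 + cconj s * y).
  by rewrite cR_abs2 rmorphD rmorph1 rmorphM /= cconjK; ring.
have cS (z : R[i]) : cR (1 + abs2 z) = 1 + z * cconj z.
  by rewrite (rmorphD (@cR R) 1 (abs2 z)) /= rmorph1 cR_abs2.
have cC : cR (bcoef l) = (-1) ^+ (k - l) * 'C(nu - k, k - l)%:R *
    (((nu - k + l)`! * k`!)%:R / (nu`! * l`!)%:R).
  rewrite /bcoef (rmorphM (@cR R)) (rmorphM (@cR R) (_ ^+ _)) rmorphXn rmorphN1 rmorph_nat.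
  by rewrite fmorph_div !rmorph_nat.
rewrite (rmorphM (@cR R) (bcoef l)) (rmorphXn (@cR R)) /= cC cS.
rewrite /bker (rmorphM (@cR R) (_ ^+ (mu - l))) !(rmorphXn (@cR R)) /= cX cS.
have -> : (mu - l = (mu - k) + (k - l))%N by lia.
have -> : cconj ((-1) ^+ k * (1 + s * cconj y) ^+ (mu - k)) =
    (-1) ^+ k * (1 + cconj s * y) ^+ (mu - k).
  by rewrite rmorphM !rmorphXn rmorphN1 rmorphD rmorph1 rmorphM /= cconjK.
rewrite exprD !exprMn.
(* The sign of the slice enters once from each side of the form and cancels. *)
have sg : (-1) ^+ k * (-1) ^+ k = 1 :> R[i] by rewrite -exprMn mulrNN mulr1 expr1n.
rewrite -[RHS]mul1r -[X in _ = X * _]sg; ring.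
Qed.

(** The difference of the two sides is |y - s|^2. *)
Lemma abs2_oneDM_le y s : abs2 (1 + y * cconj s) <= (1 + abs2 s) * (1 + abs2 y).
Proof.
rewrite -subr_ge0 (_ : _ - _ = abs2 (y - s)) ?abs2_ge0 //.
by case: y => a b; case: s => c d; rewrite /abs2 /cconj /cRe /cIm /=; ring.
Qed.

Lemma adm_bker l y f : bmeas f -> (l <= k)%N -> adm mu (fun s => f s * cR (bker l y s)).
Proof.
move=> bf lk.
have Y1 := oneDabs2_ge1 y; have Y0 := oneDabs2_gt0 y.
apply: (@adm_bmeasM _ _ _ _ ((1 + abs2 y) ^+ mu)) => //.
- apply: Cmeas_cR; apply: measurable_funM; apply: measurable_funX.
    apply: measurable_abs2; apply: CmeasD; first exact: Cmeas_cst.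
    apply: CmeasM; first exact: Cmeas_cst.
    exact/Cmeas_conj/Cmeas_zpt.
  apply: measurable_funD; first exact: measurable_cst.
  exact/measurable_abs2/Cmeas_zpt.
- by rewrite exprn_ge0 // ltW.
- move=> s; have S0 := oneDabs2_gt0 s.
  rewrite abs2_cR ler_sqr ?nnegrE; last 2 first.
  + by rewrite /bker mulr_ge0 // exprn_ge0 ?abs2_ge0 // ltW.
  + by rewrite mulr_ge0 // exprn_ge0 // ltW.
  rewrite /bker.
  have -> : (1 + abs2 s) ^+ mu = (1 + abs2 s) ^+ (mu - l) * (1 + abs2 s) ^+ l.
    by rewrite -exprD subnK //; lia.
  rewrite mulrA; apply: ler_wpM2r; first by rewrite exprn_ge0 // ltW.
  apply: (@le_trans _ _ (((1 + abs2 s) * (1 + abs2 y)) ^+ (mu - l))).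
    apply: lerXn2r; rewrite ?nnegrE ?abs2_ge0 ?abs2_oneDM_le //.
    by rewrite mulr_ge0 // ltW.
  rewrite exprMn mulrC; apply: ler_wpM2r; first by rewrite exprn_ge0 // ltW.
  by apply: ler_weXn2l => //; lia.
Qed.

(** The factor (1 + |s|^2)^l lowers the weight exponent mu + 2 of diota_mu to (mu - l) + 2, that of
    the Berezin kernel of level mu - l against diota_0. The factor mu + 1 cancels against the
    normalization of [Rstar]. *)
Lemma Berezin_bker l y f : bmeas f -> (l <= k)%N ->
  cR mu.+1%:R^-1 * int_iota mu (fun s => f s * cR (bker l y s)) =
  cR ((1 + abs2 y) ^+ (mu - l)) * Berezin (mu - l) f y.
Proof.
move=> bf lk; have ab := adm_bker y bf lk.
have Y0 := oneDabs2_gt0 y; have Yn : (1 + abs2 y) ^+ (mu - l) != 0.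
  by rewrite expf_neq0 // gt_eqF.
suff -> : Berezin (mu - l) f y = cR (mu.+1%:R * (1 + abs2 y) ^+ (mu - l))^-1 *
    int_iota mu (fun s => f s * cR (bker l y s)).
  rewrite mulrA -rmorphM /= invfM mulrCA divff // mulr1.
  by congr (cR _ * _).
rewrite /Berezin !int_iotaE -CintegralZ //; congr Cintegral; apply/funext => p.
have S0 := oneDabs2_gt0 (zpt p).
rewrite mulrAC -rmorphM /= [RHS]mulrC -!mulrA -!rmorphM /= mulrC; congr (_ * cR _).
rewrite /bker !densE.
have -> : (mu + 2 = (mu - l) + l + 2)%N by lia.
rewrite add0n !exprD.
have Sn j : (1 + abs2 (zpt p)) ^+ j != 0 by rewrite expf_neq0 // gt_eqF.
have pi0 : pi != 0 :> R by rewrite gt_eqF // pi_gt0.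
have m0 : mu.+1%:R != 0 :> R by rewrite pnatr_eq0.
move: (abs2 (1 + _) ^+ _) ((1 + abs2 y) ^+ (mu - l)) Yn => a b b0.
move: (1 + abs2 _) Sn => S Sn.
move: (S ^+ (mu - l)) (Sn (mu - l)%N) (S ^+ l) (Sn l) (S ^+ 2) (Sn 2%N) => u u0 v v0 w w0.
move: (@pi R) (mu.+1%:R) pi0 m0 => r m r0 m0.
by field; rewrite b0 u0 v0 w0 r0 m0.
Qed.

(** Pairing the two numerator products factor by factor gives products of two nonpositive numbers,
    since k <= mu < nu. This justifies C^2 = [Csq] for the square root C. *)
Lemma Csq_ge0 : 0 <= Csq mu nu k :> R.
Proof.
rewrite /Csq /poch -big_split /=; apply: divr_ge0.
  apply: prodr_ge0 => i _; have ik := ltn_ord i.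
  apply: mulr_le0; rewrite addrC subr_le0 ler_nat; lia.
rewrite mulr_ge0 ?ler0n //; apply: prodr_ge0 => i _.
apply: addr_ge0; last exact: ler0n.
apply: addr_ge0; last exact: ler0n.
by rewrite subr_ge0 -natrD -natrM ler_nat; lia.
Qed.

Lemma Eop_expansion f Q y : bmeas f -> is_adjoint_Pk mu nu k Q ->
  Eop mu nu k Q f y =
  cR (Csq mu nu k) * \sum_(l < k.+1) cR (bcoef l) * Berezin (mu - l) f y.
Proof.
move=> bf adj; pose c : R := Cmnk mu nu k.
have sP := size_gP (R := R) kmu munu y; have sQ := size_gQ (R := R) kmu munu y.
have scQ t : (size (cR c *: gQ nu (k := k) y t) <= nu.+1)%N.
  by rewrite (leq_trans (size_scale_leq _ _)).
have [A [sA fA] tE] := tensI_tsum (fun t => cR c *: gQ nu y t) bf sP.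
rewrite /Eop /Rtau /Top (adjoint_Kern kmu munu y adj) tE /Pk Jk_ip2.
rewrite (ip2_tsum sA scQ sP sQ).
have aPP t u := adm_poly bf (sP t) (sP u).
(* The operator is traded for its weak form, and the finite double sum moves under one integral over
   s. *)
have -> : \sum_(i < k.+1) \sum_(j < k.+1) hform mu (A i) (gP mu y j) * hform nu (cR c *: gQ nu y i) (gQ nu y j) =
  cR c * (cR mu.+1%:R^-1 * int_iota mu (fun s => f s * \sum_(t < k.+1) \sum_(u < k.+1)
     ((gP mu y t).[s] * cconj (gP mu y u).[s]) * hform nu (gQ nu (k := k) y t) (gQ nu y u))).
  rewrite (@eq_int_iota _ _ _ (fun s => \sum_(t < k.+1) \sum_(u < k.+1)
     hform nu (gQ nu (k := k) y t) (gQ nu y u) *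
     (f s * ((gP mu y t).[s] * cconj (gP mu y u).[s])))); last first.
    move=> s; rewrite mulr_sumr; apply: eq_bigr => t _; rewrite mulr_sumr.
    by apply: eq_bigr => u _; ring.
  rewrite int_iota_sum; last by move=> t _; apply: adm_sum => u _; exact: admZ.
  rewrite !mulr_sumr; apply: eq_bigr => t _.
  rewrite int_iota_sum; last by move=> u _; exact: admZ.
  rewrite !mulr_sumr; apply: eq_bigr => u _.
  rewrite (int_iotaZ _ (aPP t u)) (fA _ _ (sP u)) hformZl; ring.
rewrite (@eq_int_iota _ _ _ (fun s => \sum_(l < k.+1)
   cR (bcoef l * (1 + abs2 y) ^+ (nu - k - (k - l))) * (f s * cR (bker l y s)))); last first.
  by move=> s; rewrite sum_gPQ_hform mulr_sumr; apply: eq_bigr => l _; rewrite mulrCA.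
have ab (l : 'I_k.+1) : adm mu (fun s => f s * cR (bker l y s)).
  by apply: adm_bker => //; rewrite -ltnS.
rewrite int_iota_sum; last by move=> l _; exact: admZ.
(* One factor C comes from P_k, the other from its adjoint. *)
have -> : Csq mu nu k = c * c by rewrite -expr2 sqr_sqrtr // Csq_ge0.
rewrite rmorphM /= !mulr_sumr mulr_suml; apply: eq_bigr => l _.
have lk : (l <= k)%N by rewrite -ltnS.
rewrite (int_iotaZ _ (ab l)) [cR _^-1 * _]mulrCA Berezin_bker //.
(* When k - l > nu - k the exponent truncates and the powers no longer match, but then [bcoef l] is
   0. *)
have [small|big] := leqP (k - l) (nu - k); last first.
  by rewrite /bcoef (bin_small big) mulr0 !mul0r !(rmorph0, mul0r, mulr0).
have Y0 : (1 + abs2 y) != 0 by rewrite gt_eqF // oneDabs2_gt0.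
(* The powers of 1 + |y|^2 from the expansion and from the Berezin kernel add up exactly to the
   normalization of R_N. *)
have -> : (1 + abs2 y) ^+ (mu + nu - 2 * k) =
    (1 + abs2 y) ^+ (nu - k - (k - l)) * (1 + abs2 y) ^+ (mu - l).
  by rewrite -exprD; congr (_ ^+ _); lia.
rewrite -/c; move: (bcoef l) (c) => b d; rewrite !(rmorphM (@cR R)) /=.
have n1 j : cR ((1 + abs2 y) ^+ j) != 0 :> R[i].
  by rewrite -(rmorph0 (@cR R)) (inj_eq (@cR_inj R)) expf_neq0.
move: (cR (_ ^+ (nu - k - (k - l)))) (n1 (nu - k - (k - l))%N) => u u0.
move: (cR (_ ^+ (mu - l))) (n1 (mu - l)%N) => v v0.
by move: (cR b) (cR d) => b' d'; field; rewrite u0 v0.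
Qed.

End Expansion.

Theorem mainTheorem3 (R : realType) (mu nu k : nat) (f : R[i] -> R[i])
  (Q : (R[i] -> R[i]) -> (R[i] -> R[i] -> R[i])) :
  (k <= mu)%N -> (mu < nu)%N ->
  in_C_CP1 f ->
  is_adjoint_Pk mu nu k Q ->
  forall z : R[i],
    Eop mu nu k Q f z =
    cR (Csq mu nu k) *
      \sum_(l < k.+1)
        cR ((-1) ^+ (k - l) * ('C(nu - k, k - l))%:R *
            (((nu - k + l)`! * k`!)%:R / ((nu`! * l`!)%:R))) *
        Berezin (mu - l) f z.
Proof.
move=> kmu munu Hf adj z; apply: Eop_expansion => //.
(* A function continuous on the sphere is bounded and Borel measurable on the plane. *)
by split; [exact: C_CP1_meas|exact: C_CP1_bounded].
Qed.
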